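(* Let $X$ be the process on $\mathcal{S}=\mathcal{V}^2\times\mathbb{T}$ defined in the context, and fix $x\in\mathcal{S}$. On any randomized extension preserving the law of $X$ under $P_x$ (that is, on any probability space carrying a process $X$ with law $P_x$ and possibly additional randomness), let $T$ be an almost surely finite random time (a $[0,\infty]$-valued random variable with $P(T<\infty)=1$, not necessarily a stopping time). If $T$ is independent of $X(T)$, then $T$ is almost surely constant.
   Context: Let $\mathcal{V}=\{0,1\}^{\mathbb{N}}$ with the product topology, and let $\mu=\bigotimes_{k\ge1}\frac{\delta_0+\delta_1}{2}$ be the fair coin-tossing probability measure on $\mathcal{V}$. Let $C\subset[1,2]$ be the standard middle-third Cantor set built from the interval $[1,2]$, and let $L\subset C$ be a fixed Cantor subset (a subset homeomorphic to the Cantor set) that is linearly independent over $\mathbb{Q}$: for every $k\ge1$, distinct $r_1,\dots,r_k\in L$ and $q_1,\dots,q_k\in\mathbb{Q}$, $\sum_{i=1}^kq_ir_i=0$ implies $q_1=\dots=q_k=0$. Let $l:\mathcal{V}^2\to L$ be a fixed homeomorphism; $l(u,v)\in[1,2]$ is the length of the directed edge from $u$ to $v$. Let $\mathbb{T}=\mathbb{R}/\mathbb{Z}$; for $z\in\mathbb{T}$ let $\bar z\in[0,1)$ be its canonical representative, and let $[\cdot]_{\mathbb{T}}$ denote reduction modulo $1$. The state space is $\mathcal{S}=\mathcal{V}^2\times\mathbb{T}$ (product topology, Borel $\sigma$-algebra $\mathcal{B}$). For $x=(u,v,z)\in\mathcal{S}$ put $r(x)=(1-\bar z)\,l(u,v)$.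 The process $X$ started from $x=(a,b,z)$, with law $P_x$, is defined as follows. Let $V_0=b$ and let $V_1,V_2,\dots$ be iid with law $\mu$. Put $J_1=r(x)$ and $J_{n+1}=J_n+l(V_{n-1},V_n)$ for $n\ge1$. Set $X(t)=\bigl(a,b,[\bar z+t/l(a,b)]_{\mathbb{T}}\bigr)$ for $0\le t<J_1$, and $X(t)=\bigl(V_{n-1},V_n,[(t-J_n)/l(V_{n-1},V_n)]_{\mathbb{T}}\bigr)$ for $J_n\le t<J_{n+1}$, $n\ge1$. The paths are right-continuous with left limits, and $P_x$ is regarded as a law on the space of such paths. *)

(* Defs.v *)
From HB Require Import structures.
From mathcomp Require Import all_boot all_order all_algebra finmap.
From mathcomp Require Import all_classical all_reals all_analysis.

Set Implicit Arguments.
Unset Strict Implicit.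
Unset Printing Implicit Defensive.

Import Order.TTheory GRing.Theory Num.Theory.
Import numFieldNormedType.Exports.

Local Open Scope classical_set_scope.
Local Open Scope ring_scope.

Definition borel (T : ptopologicalType) : measurableType (@open T).-sigma :=
  g_sigma_algebraType (@open T).

Definition homeomorphism (T U : topologicalType) (f : T -> U) : Prop :=
  continuous f /\
  exists g : U -> T, [/\ continuous g, cancel f g & cancel g f].

Section independence.
Context d (Omega : measurableType d) (R : realType) (P : probability Omega R).

Definition independent d1 d2 (T1 : measurableType d1) (T2 : measurableType d2)
    (X : Omega -> T1) (Y : Omega -> T2) : Prop :=
  forall A B, measurable A -> measurable B ->
  P (X @^-1` A `&` Y @^-1` B) = (P (X @^-1` A) * P (Y @^-1` B))%E.

Definition iid d1 (T1 : measurableType d1) (mu : probability T1 R)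
    (V : {RV P >-> T1}^nat) : Prop :=
  (forall n A, measurable A -> P (V n @^-1` A) = mu A) /\
  (forall (J : {fset nat}) (A : nat -> set T1),
    (forall n, measurable (A n)) ->
    P (\bigcap_(n in [set` J]) V n @^-1` A n) =
    (\prod_(n <- J) P (V n @^-1` A n))%E).

End independence.

Section coin_tossing.
Context (R : realType).

(* The infinite product of the measures (\d_0 + \d_1) / 2 is the unique
   probability measure with these values on the measurable rectangles. *)
Definition fair_coin_measure (mu : probability (borel cantor_space) R) : Prop :=
  forall (J : {fset nat}) (A : nat -> set bool),
  mu [set v : cantor_space | forall k, k \in J -> A k (v k)] =
  (\prod_(k <- J) ((2^-1)%:E * (\d_false (A k) + \d_true (A k))))%E.

End coin_tossing.

Section lengths.
Context (R : realType).

Fixpoint cantor_stage (n : nat) : set R :=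
  if n is m.+1 then
    [set 1 + (y - 1) / 3 | y in cantor_stage m] `|`
    [set 2 + (y - 2) / 3 | y in cantor_stage m]
  else `[1, 2].

Definition middle_third_cantor : set R := \bigcap_n cantor_stage n.

Definition cantor_subset (L : set R) : Prop :=
  exists f : cantor_space -> set_type L, homeomorphism f.

Definition rat_independent (L : set R) : Prop :=
  forall (k : nat) (r : 'I_k -> R) (q : 'I_k -> rat),
  injective r -> (forall i, L (r i)) ->
  \sum_(i < k) ratr (q i) * r i = 0 -> forall i, q i = 0.

End lengths.

Section circle.
Context (R : realType).

Definition eq_mod1 (x y : R) : bool := x - y \is a Num.int.

Let eq_mod1_refl : reflexive eq_mod1.
Proof. by move=> x; rewrite /eq_mod1 subrr rpred0. Qed.

Let eq_mod1_sym : symmetric eq_mod1.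
Proof. by move=> x y; rewrite /eq_mod1 -opprB rpredN. Qed.

Let eq_mod1_trans : transitive eq_mod1.
Proof.
move=> y x z xy yz; rewrite /eq_mod1 (_ : x - z = (x - y) + (y - z)).
  exact: rpredD.
by rewrite addrA subrK.
Qed.

Canonical eq_mod1_equiv :=
  EquivRel eq_mod1 eq_mod1_refl eq_mod1_sym eq_mod1_trans.

Local Open Scope quotient_scope.

Definition circle : Type := quotient_topology {eq_quot eq_mod1_equiv}.

HB.instance Definition _ := Quotient.on circle.
HB.instance Definition _ :=
  PointedTopological.copy circle (quotient_topology {eq_quot eq_mod1_equiv}).

Definition mod1 (y : R) : circle := \pi_circle%qT y.

Definition circle_repr (z : circle) : R :=
  repr z - (Num.floor (repr z))%:~R.

Lemma circle_repr_itv (z : circle) : 0 <= circle_repr z < 1.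
Proof.
have /andP[ge_fl lt_fl] := floor_itv (repr z).
by rewrite /circle_repr subr_ge0 ge_fl ltrBlDl addrC -[1]/(1%:~R) -intrD addrC.
Qed.

Lemma circle_reprK (z : circle) : mod1 (circle_repr z) = z.
Proof.
rewrite -[RHS]reprK; apply/eqmodP.
by rewrite /= /eq_mod1 /circle_repr addrAC subrr sub0r rpredN intr_int.
Qed.

Definition state : Type := cantor_space * cantor_space * circle.

HB.instance Definition _ :=
  Topological.copy state (cantor_space * cantor_space * circle)%type.
HB.instance Definition _ := isPointed.Build state (point, point, point).

End circle.

Section path_space.
Context (R : realType).

Definition cadlag (f : R -> state R) : Prop :=
  (forall t : R, 0 <= t -> f s @[s --> t^'+] --> f t) /\
  (forall t : R, 0 < t -> exists y : state R, f s @[s --> t^'-] --> y).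

(* Time is [0, +oo[: the values at negative times are arbitrary, and are
   neither constrained by [cadlag] nor seen by [path_cylinders]. The sigma-algebra
   generated by the evaluations at nonnegative times is the Borel sigma-algebra
   of the Skorokhod topology, the state space being Polish. *)
Record cadlag_path : Type := CadlagPath {
  path_fun :> R -> state R ;
  path_cadlag : cadlag path_fun }.

HB.instance Definition _ := gen_eqMixin cadlag_path.
HB.instance Definition _ := gen_choiceMixin cadlag_path.

Let cadlag_cst : cadlag (fun=> point).
Proof. by split=> t _; [exact: cvg_cst|exists point; exact: cvg_cst]. Qed.

HB.instance Definition _ := isPointed.Build cadlag_path (CadlagPath cadlag_cst).

Definition path_cylinders : set (set cadlag_path) :=
  [set E | exists (t : R) (B : set (borel (state R))),
    [/\ 0 <= t, measurable B & E = [set f : cadlag_path | B (f t)]]].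

Definition path_space : measurableType path_cylinders.-sigma :=
  g_sigma_algebraType path_cylinders.

End path_space.

Section process.
Context (R : realType) (L : set R) (l : cantor_space * cantor_space -> L).

Definition len (u v : cantor_space) : R := set_val (l (u, v)).

Definition residual (x : state R) : R :=
  let: (u, v, z) := x in (1 - circle_repr z) * len u v.

(* [v n] is V_(n+1); [vertex x v n] is V_n, with V_0 the head
   of the initial edge. *)
Definition vertex (x : state R) (v : nat -> cantor_space) (n : nat) :
    cantor_space :=
  if n is m.+1 then v m else x.1.2.

(* [jump x v n] is J_(n+1). *)
Fixpoint jump (x : state R) (v : nat -> cantor_space) (n : nat) : R :=
  if n is m.+1 then jump x v m + len (vertex x v m) (vertex x v m.+1)
  else residual x.

(* Edge lengths are at least 1, so jump times tend to +oo and [f] is determined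
   on [0, +oo[. *)
Definition walks (x : state R) (v : nat -> cantor_space) (f : R -> state R) :
    Prop :=
  (forall t : R, 0 <= t < jump x v 0 ->
    let: (a, b, z) := x in f t = (a, b, mod1 (circle_repr z + t / len a b))) /\
  (forall (n : nat) (t : R), jump x v n <= t < jump x v n.+1 ->
    let u := vertex x v n in let w := vertex x v n.+1 in
    f t = (u, w, mod1 ((t - jump x v n) / len u w))).

(* [Q] is the law P_x, the image of the law of an iid sequence of vertices.
   It does not depend on the space carrying that sequence. *)
Definition is_law (mu : probability (borel cantor_space) R) (x : state R)
    (Q : probability (path_space R) R) : Prop :=
  exists (d : measure_display) (Omega : measurableType d)
    (P : probability Omega R) (V : {RV P >-> borel cantor_space}^nat)
    (X : {RV P >-> path_space R}),
  [/\ iid mu V,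
      forall w, walks x (fun n => V n w) (X w : cadlag_path R) &
      forall E, measurable E -> Q E = distribution P X E].

End process.

(* Main.v *)
From HB Require Import structures.
Require Import Defs.
From mathcomp Require Import all_boot all_order all_algebra finmap.
From mathcomp Require Import all_classical all_reals all_analysis.
From mathcomp Require Import measurable_realfun.
From mathcomp Require Import ring lra zify.

Set Implicit Arguments.
Unset Strict Implicit.
Unset Printing Implicit Defensive.

Import Order.TTheory GRing.Theory Num.Theory.
Import numFieldNormedType.Exports.

Local Open Scope classical_set_scope.
Local Open Scope ring_scope.

(** A run of the process is an itinerary: the initial edge (a, b), then the
    edges (b, V_1), (V_1, V_2), and so on. If at time t the process is on the
    edge e_n of its itinerary, at phase z, then

      t + (elapsed time on e_0 at time 0) = l(e_0) + ... + l(e_(n-1)) + z l(e_n).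

    Almost surely the heads b, V_1, V_2, ... are pairwise distinct, and two
    independent runs share no head apart from b.

    Take two independent copies (t, y), (t', y') of the pair (T, X(T)). Since T
    and X(T) are independent, exchanging the two states gives two further
    independent copies (t, y'), (t', y) of the same pair. So, almost surely,
    each of the four pairs is explained by an itinerary as above, and we get
    paths p(t, y), p(t', y'), p(t, y'), p(t', y) that start with the same edge,
    where the first two meet nowhere after b. Adding the equations for the
    first two pairs and subtracting those for the last two eliminates the times
    and the phases: the edge lengths of p(t, y) and p(t', y') have the same sum
    as those of p(t, y') and p(t', y). As the lengths are linearly independent
    over the rationals, the two multisets of edges coincide. In particular each
    edge of p(t', y) belongs to p(t, y) or to p(t', y'), where an edge is
    determined by its head; following p(t', y) backwards from the edge carried
    by y, which is also the last edge of p(t, y), we retrace p(t, y)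
    ([backtrack]). Both paths have the same length and the same final phase, so
    t = t' ([exchange_itineraries]). Thus two independent copies of T are almost
    surely equal, and T is almost surely constant ([copies_equal_constant]).

    To transfer an almost sure property from the first two pairs to the
    exchanged ones, it must be a measurable condition on the four observed
    quantities alone, although it speaks of unobserved paths. For a given number
    of edges and a given lower bound on the distances between heads, the
    observations that are explained by some paths form the preimage of a compact
    set under a continuous map, hence a closed set ([closed_pair_fit]); and two
    random matrices with the same probabilities on boxes have the same
    probabilities on closed sets and on their countable unions
    ([bigcup_closed_law_eq]).

    Only the law of X is given, so the itinerary has to be read off the path:
    the jump times and the edges are obtained one after the other by evaluating
    the path at the previous jump time, which is measurable because paths are
    right-continuous ([observable_random_time]). The paths that behave at all
    times as their decoded itinerary predicts form a measurable set
    ([measurable_regular]), of full measure ([is_law_regular]). *)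

(** * The circle and its continuous functions *)

Section circle_theory.
Context (R : realType).
Implicit Types (y a : R) (z : circle R).

Lemma circle_repr_mod1_int y :
  exists k : int, circle_repr (mod1 y) = y + k%:~R.
Proof.
have /eqmodP := circle_reprK (mod1 y).
rewrite /= /eq_mod1 => /intrP[k hk]; exists k.
by rewrite -hk addrC subrK.
Qed.

Lemma circle_repr_mod1 y : 0 <= y < 1 -> circle_repr (mod1 y) = y.
Proof.
move=> /andP[y0 y1]; have [k hk] := circle_repr_mod1_int y.
have := circle_repr_itv (mod1 y); rewrite hk => /andP[h0 h1].
have k0 : k = 0.
  have : (-1 < k)%R by rewrite -(ltr_int R) rmorphN1; lra.
  have : (k < 1)%R by rewrite -(ltr_int R) rmorph1; lra.
  lia.
by rewrite k0 addr0.
Qed.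

Lemma cosD2pi_int y (k : int) : cos (y + pi *+ 2 * k%:~R) = cos y :> R.
Proof.
case: k => n.
  by rewrite -pmulrn mulr_natr (periodicn (@cosD2pi R)).
rewrite NegzE -[in RHS](subrK (pi *+ 2 *+ n.+1) y) (periodicn (@cosD2pi R)).
by rewrite mulrNz mulrN -pmulrn mulr_natr.
Qed.

(** The product 2 sin (pi z) sin (pi (z - a)), written as a difference of
    cosines to make its periodicity in z apparent. It serves as a continuous
    substitute for the representative in [0, 1), which jumps at 0. *)
Definition phase_test a z : R :=
  cos (pi * a) - cos (pi *+ 2 * circle_repr z - pi * a).

Lemma phase_test_mod1 a y :
  phase_test a (mod1 y) = cos (pi * a) - cos (pi *+ 2 * y - pi * a).
Proof.
rewrite /phase_test; have [k ->] := circle_repr_mod1_int y; congr (_ - _).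
by rewrite mulrDr addrAC cosD2pi_int.
Qed.

Lemma phase_test_continuous a : continuous (phase_test a).
Proof.
apply/(quotient_continuous (phase_test a : circle R -> R)).
rewrite (_ : _ \o _ =
  fun y => cos (pi * a) - cos (pi *+ 2 * y - pi * a)); last first.
  by apply/funext => y; rewrite -phase_test_mod1.
move=> y; apply: cvgB; first exact: cvg_cst.
apply: (@continuous_comp _ _ _ (fun y => pi *+ 2 * y - pi * a) (@cos R)).
  by apply: cvgB; [apply: cvgMr; exact: cvg_id|exact: cvg_cst].
exact: continuous_cos.
Qed.

(** For z in [0, 1) the factor sin (pi z) is nonnegative and sin (pi (z - a))
    has the sign of z - a. *)
Lemma phase_test_gt0 a z : 0 <= a < 1 -> (0 < phase_test a z) = (a < circle_repr z).
Proof.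
move=> /andP[a0 a1]; have /andP[z0 z1] := circle_repr_itv z.
set w := circle_repr z in z0 z1 *.
have -> : phase_test a z = 2 * (sin (pi * w) * sin (pi * (w - a))).
  rewrite /phase_test -/w.
  have -> : pi * a = pi * w - pi * (w - a) by ring.
  have -> : pi *+ 2 * w - (pi * w - pi * (w - a)) = pi * w + pi * (w - a) by ring.
  by rewrite cosB cosD; ring.
rewrite pmulr_rgt0//; have p0 := pi_gt0 R.
have sw0 : 0 <= sin (pi * w).
  by apply: sin_ge0_pi; rewrite mulr_ge0 ?pi_ge0//= ler_piMr ?pi_ge0// ltW.
have [aw|wa] := ltP a w.
  by rewrite mulr_gt0//; apply: sin_gt0_pi; apply/andP; split; nra.
apply/negbTE; rewrite -leNgt mulr_ge0_le0// -opprB mulrN sinN oppr_le0.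
apply: sin_ge0_pi; rewrite mulr_ge0 ?pi_ge0 ?subr_ge0//= ler_piMr ?pi_ge0//; lra.
Qed.

Lemma phase_test_inj z z' :
  (forall a, phase_test a z = phase_test a z') -> circle_repr z = circle_repr z'.
Proof.
move=> h; have /andP[z0 z1] := circle_repr_itv z.
have /andP[z'0 z'1] := circle_repr_itv z'.
have [zz'|z'z|//] := ltgtP (circle_repr z) (circle_repr z').
  have := phase_test_gt0 z' (circle_repr_itv z).
  by rewrite zz' -h (phase_test_gt0 z) ?circle_repr_itv// ltxx.
have := phase_test_gt0 z (circle_repr_itv z').
by rewrite z'z h (phase_test_gt0 z') ?circle_repr_itv// ltxx.
Qed.

End circle_theory.

(** * Edge lengths *)

Section length_theory.
Context (R : realType) (L : set R) (l : cantor_space * cantor_space -> L).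
Hypotheses (L_sub : L `<=` @middle_third_cantor R) (l_homeo : homeomorphism l).
Implicit Types u v : cantor_space.

Lemma len_in u v : L (len l u v).
Proof. exact: set_valP. Qed.

Lemma len_ge1 u v : 1 <= len l u v.
Proof.
by have /L_sub/(_ 0 I) := len_in u v; rewrite /= in_itv/= => /andP[].
Qed.

Lemma len_gt0 u v : 0 < len l u v.
Proof. exact: lt_le_trans (len_ge1 u v). Qed.

Lemma len_inj u v u' v' : len l u v = len l u' v' -> (u, v) = (u', v').
Proof.
have [_ [g [_ lK _]]] := l_homeo.
by move=> /val_inj/(congr1 g); rewrite !lK.
Qed.

Lemma len_continuous (U : topologicalType) (f g : U -> cantor_space) :
  continuous f -> continuous g -> continuous (fun w => len l (f w) (g w)).
Proof.
have [lc _] := l_homeo => fc gc w.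
apply: (@continuous_comp _ _ _ (fun w => l (f w, g w)) (set_val : L -> R)).
  apply: (@continuous_comp _ _ _ (fun w => (f w, g w)) l); last exact: lc.
  exact: (cvg_pair (fc w) (gc w)).
exact: initial_continuous.
Qed.

End length_theory.

(** * Rational independence *)

Lemma sum_count (V : nmodType) (s t : seq V) :
  uniq s -> {subset t <= s} ->
  \sum_(r <- t) r = \sum_(r <- s) r *+ count_mem r t.
Proof.
move=> us; elim: t => [_|x t IH ts].
  by rewrite big_nil big1.
rewrite big_cons IH; last by move=> y yt; apply: ts; rewrite inE yt orbT.
under [RHS]eq_bigr do rewrite /= mulrnDr.
rewrite big_split/=; congr (_ + _).
rewrite (bigD1_seq x) ?ts ?mem_head//= eqxx big1 ?addr0// => y yx.
by rewrite eq_sym (negbTE yx).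
Qed.

(** The differences of the multiplicities in the two lists are the coefficients
    of a vanishing rational combination of distinct elements of [L]. *)
Lemma rat_independent_perm (R : realType) (L : set R) (s1 s2 : seq R) :
  rat_independent L -> (forall r, r \in s1 ++ s2 -> L r) ->
  \sum_(r <- s1) r = \sum_(r <- s2) r -> perm_eq s1 s2.
Proof.
move=> L_indep sL sE; set s := undup (s1 ++ s2).
have us : uniq s by exact: undup_uniq.
have s1s : {subset s1 <= s} by move=> r rs; rewrite mem_undup mem_cat rs.
have s2s : {subset s2 <= s} by move=> r rs; rewrite mem_undup mem_cat rs orbT.
pose q (i : 'I_(size s)) : rat :=
  (count_mem s`_i s1)%:R - (count_mem s`_i s2)%:R.
have q0 : forall i, q i = 0.
  apply: (L_indep _ (fun i => s`_i)).
  - by move=> i j /eqP; rewrite nth_uniq// => /eqP/val_inj.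
  - by move=> i; apply: sL; rewrite -mem_undup; exact: mem_nth.
  - transitivity (\sum_(r <- s) ((count_mem r s1)%:R - (count_mem r s2)%:R) * r).
      rewrite (big_nth 0) big_mkord; apply: eq_bigr => i _.
      by rewrite /q rmorphB/= !ratr_nat.
    under eq_bigr do rewrite mulrBl !mulr_natl.
    by rewrite sumrB -!sum_count// sE subrr.
have cE r : r \in s -> count_mem r s1 = count_mem r s2.
  move=> /(nthP 0)[i is_ <-].
  by have /eqP := q0 (Ordinal is_); rewrite subr_eq0 eqr_nat => /eqP.
apply/allP => r; rewrite mem_cat => /orP[rs|rs]; apply/eqP/cE.
  exact: s1s.
exact: s2s.
Qed.

(** * Itineraries and their exchange *)

Section itinerary.
Context (R : realType) (L : set R) (l : cantor_space * cantor_space -> L).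
Context (x : state R).
Hypothesis l_homeo : homeomorphism l.
Hypothesis L_indep : rat_independent L.
Implicit Types (v w : nat -> cantor_space) (n m : nat) (t r z : R).

(** Edge number 0 is the initial edge, so edge number n + 1 leads from vertex n
    to vertex n + 1 of the walk. *)
Definition tail v n : cantor_space :=
  if n is m.+1 then vertex x v m else x.1.1.

Definition edge v n : R := len l (tail v n) (vertex x v n).

(** The time of departure along edge n; for n = 0 it is the nonpositive time at
    which the process would have started from the origin of its initial edge. *)
Definition departure v n : R :=
  - (circle_repr x.2 * len l x.1.1 x.1.2) + \sum_(i < n) edge v i.

(** What an observer sees at time [t] on edge [n]: the edge, through its length
    [r], and the phase [z]. *)
Definition fits v n t r z : Prop :=
  r = edge v n /\ t = departure v n + z * r.

Definition simple v n : Prop :=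
  forall i j, (i <= n)%N -> (j <= n)%N -> vertex x v i = vertex x v j -> i = j.

(** The vertex of index 0 is common to all itineraries, hence the restriction to
    positive indices. *)
Definition apart v n w m : Prop :=
  forall i j, (0 < i <= n)%N -> (0 < j <= m)%N -> vertex x v i <> vertex x w j.

Lemma edge_inj v w i j : edge v i = edge w j ->
  tail v i = tail w j /\ vertex x v i = vertex x w j.
Proof. by move=> /(len_inj l_homeo)[]. Qed.

(** In the union of the paths [v] and [v'] every vertex is the head of only one
    edge, the initial edge being common to both. So the predecessor of each
    edge of [w] is forced, and from the common last edge on, [w] goes back
    along [v], never along [v']. It cannot stop before [v] does, nor after,
    because the initial edge is the only one in [v] or in [w] with its head. *)
Lemma backtrack v n w m v' n' :
  simple v n -> simple v' n' -> apart v n v' n' -> simple w m ->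
  edge w m = edge v n ->
  (forall j, (j < m)%N -> (exists2 i, (i < n)%N & edge w j = edge v i) \/
                          (exists2 i, (i < n')%N & edge w j = edge v' i)) ->
  departure w m = departure v n.
Proof.
move=> sv sv' av sw ewv sub.
(* The edges of [w] and [v] coincide when numbered from the last one. *)
have back k : (k <= m)%N -> (k <= n)%N /\ edge w (m - k) = edge v (n - k).
  elim: k => [|k IH] km; first by rewrite !subn0.
  have [kn ek] := IH (ltnW km); have [tk hk] := edge_inj ek.
  have kn' : (k < n)%N.
    rewrite ltn_neqAle kn andbT; apply/negP => /eqP kn0.
    by move: hk; rewrite kn0 subnn /= => /(sw _ 0%N (leq_subr _ _) isT); lia.
  split => //.
  have mE : (m - k = (m - k.+1).+1)%N by lia.
  have nE : (n - k = (n - k.+1).+1)%N by lia.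
  move: tk; rewrite mE nE /= => tk.
  have [|[i ilt ei]|[i ilt ei]] := sub (m - k.+1)%N; first by lia.
    have [_ hi] := edge_inj ei.
    by rewrite ei (sv i (n - k.+1)%N) -?hi//; lia.
  have [_ hi] := edge_inj ei; move: hi; rewrite tk => hi.
  have [i0|i0] := posnP i.
    rewrite i0 in hi ei *.
    by rewrite ei (sv (n - k.+1)%N 0%N)//; lia.
  have [n0|n0] := posnP (n - k.+1)%N.
    by have := sv' 0%N i isT (ltnW ilt); rewrite n0 /= in hi; move=> /(_ hi); lia.
  by case: (av (n - k.+1)%N i); rewrite ?hi//; lia.
have [mn] := back _ (leqnn m); rewrite subnn => e0.
have nm : n = m.
  have [_] := edge_inj e0 => /= /(sv 0%N (n - m)%N isT (leq_subr _ _)). lia.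
rewrite /departure nm; congr (_ + _); apply: eq_bigr => i _.
by have [|_] := back (m - i)%N; rewrite ?leq_subr// nm subKn// ltnW.
Qed.

Lemma sum_edge v n : \sum_(i < n) edge v i = \sum_(r <- [seq edge v i | i <- iota 0 n]) r.
Proof. by rewrite big_map -(big_mkord predT (edge v)) /index_iota subn0. Qed.

(** In the sum of the first two time equations minus the last two, everything
    cancels except the lengths of the edges left behind, which by rational
    independence are therefore the same, with multiplicity, for [v], [v'] as
    for [w], [w']. Then [w'] retraces [v]. *)
Lemma exchange_itineraries v n v' n' w m w' m' t t' r r' z z' :
  simple v n -> simple v' n' -> apart v n v' n' -> simple w' m' ->
  fits v n t r z -> fits v' n' t' r' z' ->
  fits w m t r' z' -> fits w' m' t' r z -> t = t'.
Proof.
move=> sv sv' av sw' [rE tE] [r'E t'E] [r'E2 tE2] [rE2 t'E2].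
pose E u k := [seq edge u i | i <- iota 0 k].
have /perm_mem Emem : perm_eq (E w m ++ E w' m') (E v n ++ E v' n').
  apply: (rat_independent_perm L_indep).
    move=> s; rewrite !mem_cat => /orP[]/orP[]/mapP[i _ ->]; exact: (len_in l).
  rewrite !big_cat/= -!sum_edge; move: tE t'E tE2 t'E2; rewrite /departure; lra.
rewrite tE t'E2; congr (_ + _); apply/esym.
apply: (backtrack sv sv' av sw'); first by rewrite -rE -rE2.
move=> j jm; have : edge w' j \in E v n ++ E v' n'.
  by rewrite -Emem mem_cat; apply/orP; right; apply: map_f; rewrite mem_iota.
rewrite mem_cat => /orP[]/mapP[i]; rewrite mem_iota/= add0n => ilt ->.
  by left; exists i.
by right; exists i.
Qed.

End itinerary.

(** * Closedness of the set of explained observations *)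

Section pair_fit.
Context (R : realType) (L : set R) (l : cantor_space * cantor_space -> L).
Context (x : state R).
Hypothesis l_homeo : homeomorphism l.

(** An injective continuous real coordinate on vertices, available because [l]
    is injective; it lets equality of vertices be handled as equality of real
    functions. *)
Definition code (v : cantor_space) : R := len l v point.

Lemma code_inj : injective code.
Proof. by move=> u v /(len_inj l_homeo)[]. Qed.

(** Two sequences of vertices, indexed jointly so that Tychonoff's theorem
    applies directly. *)
Definition pair_of := prod_topology (fun _ : bool * nat => cantor_space).

Lemma pair_of_compact : compact [set: pair_of].
Proof.
have := @tychonoff _ (fun _ : bool * nat => cantor_space) _
  (fun=> cantor_space_compact).
by congr (compact _); rewrite eqEsubset.
Qed.

Definition branch (b : bool) (q : pair_of) : nat -> cantor_space :=
  fun k => q (b, k).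

Lemma vertex_continuous b n : continuous (fun q => vertex x (branch b q) n).
Proof.
case: n => [|n]; first by move=> q; exact: cvg_cst.
exact: (@proj_continuous _ (fun _ : bool * nat => cantor_space) (b, n)).
Qed.

Lemma tail_continuous b n : continuous (fun q => tail x (branch b q) n).
Proof.
case: n => [|n]; first by move=> q; exact: cvg_cst.
exact: vertex_continuous.
Qed.

Lemma edge_continuous b n : continuous (fun q => edge l x (branch b q) n).
Proof.
exact: (len_continuous l_homeo (@tail_continuous b n) (@vertex_continuous b n)).
Qed.

Lemma departure_continuous b n :
  continuous (fun q => departure l x (branch b q) n).
Proof.
have sc : continuous (fun q => \sum_(i < n) edge l x (branch b q) i).
  elim: n => [|n IH].
    rewrite (_ : (fun q => _) = fun=> 0); first by move=> q; exact: cvg_cst.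
    by apply/funext => q; rewrite big_ord0.
  rewrite (_ : (fun q => _) = fun q =>
    \sum_(i < n) edge l x (branch b q) i + edge l x (branch b q) n).
    by move=> q; apply: cvgD; [exact: IH|exact: edge_continuous].
  by apply/funext => q; rewrite big_ord_recr.
by move=> q; apply: cvgD; [exact: cvg_cst|exact: sc].
Qed.

Lemma code_continuous b n :
  continuous (fun q => code (vertex x (branch b q) n)).
Proof.
apply: (len_continuous l_homeo); first exact: vertex_continuous.
by move=> q; exact: cvg_cst.
Qed.

(** Each row is an observation (time, length of the current edge, phase). The
    lower bound [e] on the distances between heads replaces their
    distinctness, which is not a closed condition. *)
Definition pair_fit (n n' : nat) (e : R) : set 'M[R]_(2, 3) :=
  [set p | exists q : pair_of,
    let v := branch false q in let v' := branch true q in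
    [/\ forall i j, (i < j <= n)%N ->
          e <= `|code (vertex x v i) - code (vertex x v j)|,
        forall i j, (i < j <= n')%N ->
          e <= `|code (vertex x v' i) - code (vertex x v' j)|,
        forall i j, (0 < i <= n)%N -> (0 < j <= n')%N ->
          e <= `|code (vertex x v i) - code (vertex x v' j)|,
        fits l x v n (p 0 0) (p 0 1) (p 0 2) &
        fits l x v' n' (p 1 0) (p 1 1) (p 1 2)]].

Lemma closed_separation b i c j (e : R) :
  closed [set q : pair_of | e <=
    `|code (vertex x (branch b q) i) - code (vertex x (branch c q) j)|].
Proof.
apply: (@preimage_closed _ _ (fun q : pair_of =>
    `|code (vertex x (branch b q) i) - code (vertex x (branch c q) j)|)
  [set r | e <= r]); last exact: closed_ge.
move=> q _; apply: cvg_norm; apply: cvgB; exact: code_continuous.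
Qed.

(** In the equations [fits] the observed quantities can be put on one side, and
    the continuous functions of the two itineraries on the other. The admissible
    itineraries form a compact set, so the right-hand sides range over a compact
    set. *)
Lemma closed_pair_fit n n' e : closed (pair_fit n n' e).
Proof.
pose F (q : pair_of) := ((edge l x (branch false q) n, departure l x (branch false q) n),
             (edge l x (branch true q) n', departure l x (branch true q) n')).
pose G (p : 'M[R]_(2, 3)) := ((p 0 1, p 0 0 - p 0 2 * p 0 1),
                              (p 1 1, p 1 0 - p 1 2 * p 1 1)).
pose C : set pair_of := [set q |
   [/\ forall i j, (i < j <= n)%N ->
         e <= `|code (vertex x (branch false q) i) - code (vertex x (branch false q) j)|,
       forall i j, (i < j <= n')%N ->
          e <= `|code (vertex x (branch true q) i) - code (vertex x (branch true q) j)| &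
       forall i j, (0 < i <= n)%N -> (0 < j <= n')%N ->
          e <= `|code (vertex x (branch false q) i) - code (vertex x (branch true q) j)|]].
have -> : pair_fit n n' e = G @^-1` (F @` C).
  rewrite eqEsubset; split => p /=.
    move=> [q [/= h1 h2 h3 [f1 f2] [g1 g2]]]; exists q => //.
    by rewrite /F /G -f1 -g1 f2 g2 !addrK.
  move=> [q [h1 h2 h3] [f1 f2 g1 g2]]; exists q; split => //.
    by split; rewrite -?f1// f2 f1 subrK.
  by split; rewrite -?g1// g2 g1 subrK.
have Fc : continuous F.
  have ec := edge_continuous; have dc := departure_continuous.
  move=> q; exact: (cvg_pair (cvg_pair (ec false n q) (dc false n q))
                             (cvg_pair (ec true n' q) (dc true n' q))).
have Gc : continuous G.
  have cc i j : continuous (fun p : 'M[R]_(2, 3) => p i j).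
    exact: coord_continuous.
  have gc i : continuous (fun p : 'M[R]_(2, 3) => p i 0 - p i 2 * p i 1).
    by move=> p; exact: (cvgB (cc i 0 p) (cvgM (cc i 2 p) (cc i 1 p))).
  move=> p; exact: (cvg_pair (cvg_pair (cc 0 1 p) (gc 0 p))
                             (cvg_pair (cc 1 1 p) (gc 1 p))).
have Cc : closed C.
  have -> : C = (\bigcap_(ij in [set ij | (ij.1 < ij.2 <= n)%N]) [set q : pair_of | e <=
    `|code (vertex x (branch false q) ij.1) - code (vertex x (branch false q) ij.2)|]) `&`
   (\bigcap_(ij in [set ij | (ij.1 < ij.2 <= n')%N]) [set q : pair_of | e <=
    `|code (vertex x (branch true q) ij.1) - code (vertex x (branch true q) ij.2)|]) `&`
   (\bigcap_(ij in [set ij | (0 < ij.1 <= n)%N && (0 < ij.2 <= n')%N])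
     [set q : pair_of | e <=
    `|code (vertex x (branch false q) ij.1) - code (vertex x (branch true q) ij.2)|]).
    rewrite eqEsubset; split => q /=.
      move=> [h1 h2 h3]; split; first split.
      - by move=> [i j] /=; exact: h1.
      - by move=> [i j] /=; exact: h2.
      - by move=> [i j] /= /andP[]; exact: h3.
    move=> [[h1 h2] h3]; split.
    - by move=> i j ij; exact: (h1 (i, j)).
    - by move=> i j ij; exact: (h2 (i, j)).
    - by move=> i j hi hj; apply: (h3 (i, j)) => /=; rewrite hi hj.
  by apply: closedI; first apply: closedI; apply: closed_bigI => ij _;
    exact: closed_separation.
apply: preimage_closed; first by move=> p _; exact: Gc.
apply: compact_closed; first exact: norm_hausdorff.
apply: continuous_compact; first exact: continuous_subspaceT.
exact: (subclosed_compact Cc pair_of_compact).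
Qed.

End pair_fit.

(** * Laws determined by boxes *)

Lemma countable_law_eq (d : measure_display) (W : measurableType d)
    (R : realType) (P : {measure set W -> \bar R}) (K : countType) (f g : W -> K) :
  (forall c, measurable (f @^-1` [set c])) ->
  (forall c, measurable (g @^-1` [set c])) ->
  (forall c, P (f @^-1` [set c]) = P (g @^-1` [set c])) ->
  forall J : set K, [/\ measurable (f @^-1` J), measurable (g @^-1` J) &
    P (f @^-1` J) = P (g @^-1` J)].
Proof.
move=> mf mg fgE J.
pose F (h : W -> K) n := if choice.unpickle n is Some c then h @^-1` [set c] else set0.
pose D := [set n | exists2 c, J c & n = choice.pickle c].
have FE h : h @^-1` J = \bigcup_(n in D) F h n.
  rewrite eqEsubset; split => w.
    by move=> Jw; exists (choice.pickle (h w)); [exists (h w)|rewrite /F choice.pickleK].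
  by move=> [_ [c Jc ->]]; rewrite /F choice.pickleK /= => hw; rewrite /preimage/= hw.
have tF h : trivIset D (F h).
  move=> _ _ [c _ ->] [c' _ ->]; rewrite /F !choice.pickleK => -[w [/= hc hc']].
  by rewrite -hc -hc'.
have mF h : (forall c, measurable (h @^-1` [set c])) -> forall n, measurable (F h n).
  by move=> mh n; rewrite /F; case: (choice.unpickle n).
split; [rewrite FE; apply: bigcup_measurable => n _; exact: mF..|].
rewrite !FE !measure_bigcup//; [|by move=> n _; exact: mF..].
apply: eq_eseriesr => n _; rewrite /F; case: (choice.unpickle n) => [c|//]; exact: fgE.
Qed.

(** Dyadic cells are nested and shrink to points, so a closed set is the
    decreasing intersection of the unions of the cells that meet it. *)
Section dyadic.
Context (R : realType) (m n : nat).
Implicit Types p : 'M[R]_(m, n).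

Definition dyadic_cell k p : {ffun 'I_m * 'I_n -> int} :=
  [ffun ij => Num.floor (2 ^+ k * p ij.1 ij.2)].

Lemma dyadic_cellS k p p' :
  dyadic_cell k.+1 p = dyadic_cell k.+1 p' -> dyadic_cell k p = dyadic_cell k p'.
Proof.
move=> /ffunP h; apply/ffunP => ij; have := h ij; rewrite !ffunE.
move: (p _ _) (p' _ _) => a b; rewrite exprS -!mulrA.
move: (2 ^+ k * a) (2 ^+ k * b) => {}a {}b ab.
apply: floor_def; apply/andP.
have /andP[b0 b1] := floor_itv b; have /andP[a0 a1] := floor_itv a.
have /andP[b2 b3] := floor_itv (2 * b); have /andP[a2 a3] := floor_itv (2 * a).
rewrite ab in a2 a3; move: (Num.floor (2 * b)) a2 a3 b2 b3 {ab} => f a2 a3 b2 b3.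
have h1 : (2 * Num.floor b <= f)%R.
  rewrite -ltzD1 -(ltr_int R); rewrite rmorphM/=; lra.
have h2 : (f + 1 <= 2 * (Num.floor b + 1))%R.
  rewrite lezD1 -(ltr_int R) rmorphM/=; lra.
move: h1 h2; rewrite -!(ler_int R) !rmorphM/= !rmorphD/= => h1 h2.
by split; rewrite ?rmorphD/=; rewrite !rmorphD/= in a3 b1; lra.
Qed.

Lemma dyadic_cell_near k p p' i j :
  dyadic_cell k p = dyadic_cell k p' -> `|p i j - p' i j| < (2 ^+ k)^-1.
Proof.
move=> /ffunP/(_ (i, j)); rewrite !ffunE /=.
move: (p i j) (p' i j) => a b ab.
have k0 : 0 < 2 ^+ k :> R by rewrite exprn_gt0.
have /andP[b0 b1] := floor_itv (2 ^+ k * b).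
have /andP[a0 a1] := floor_itv (2 ^+ k * a).
rewrite -(ltr_pM2l k0) divff ?gt_eqF// -[X in X * _](gtr0_norm k0) -normrM mulrBr.
by rewrite ltr_norml; rewrite ab in a0 a1; rewrite !rmorphD/= in a1 b1; lra.
Qed.

Lemma closed_dyadic_cells (C : set 'M[R]_(m, n)) : closed C ->
  C = \bigcap_k (dyadic_cell k @^-1` (dyadic_cell k @` C)).
Proof.
move=> cC; rewrite eqEsubset; split => p.
  by move=> Cp k _; exists p.
move=> h; apply: cC => B /nbhs_ballP[e /= e0 eB].
have [k ke] : exists k, (2 ^+ k)^-1 < e :> R.
  have [k _ /(_ k (leqnn k))] := near_infty_natSinv_lt (PosNum e0).
  move=> /= ke; exists k; apply: le_lt_trans ke.
  rewrite lef_pV2 ?posrE ?exprn_gt0//.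
  by rewrite -natrX ler_nat; exact: ltn_expl.
have [q Cq qp] := h k I; exists q; split => //; apply: eB.
split=> // i j; rewrite /ball/=; apply: lt_trans ke.
by apply: dyadic_cell_near; rewrite qp.
Qed.

End dyadic.

Section closed_law.
Context (d : measure_display) (W : measurableType d) (R : realType).
Context (P : {finite_measure set W -> \bar R}) (m n : nat).
Context (Phi Psi : W -> 'M[R]_(m, n)).
Hypothesis mPhi : forall i j, measurable_fun setT (fun w => Phi w i j).
Hypothesis mPsi : forall i j, measurable_fun setT (fun w => Psi w i j).
Hypothesis box_eq : forall A : 'I_m -> 'I_n -> set R,
  (forall i j, measurable (A i j)) ->
  P [set w | forall i j, A i j (Phi w i j)] = P [set w | forall i j, A i j (Psi w i j)].

Definition floor_preimage k (c : int) : set R := [set r | Num.floor (2 ^+ k * r) = c].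

Lemma measurable_floor_preimage k c : measurable (floor_preimage k c).
Proof.
have -> : floor_preimage k c =
    [set r | c%:~R <= 2 ^+ k * r] `&` [set r | 2 ^+ k * r < (c + 1)%:~R].
  rewrite eqEsubset; split => r /=.
    by rewrite /floor_preimage /= => <-; apply/andP; exact: floor_itv.
  by move=> [h1 h2]; apply: floor_def; rewrite h1 h2.
have mM : measurable_fun setT (fun r : R => 2 ^+ k * r).
  exact: measurable_funM.
apply: measurableI; rewrite -[X in measurable X]setTI.
  have := mM measurableT `[c%:~R, +oo[%classic (measurable_itv _).
  by congr (measurable (_ `&` _)); apply/seteqP; split => r /=; rewrite in_itv/= andbT.
have := mM measurableT `]-oo, (c + 1)%:~R[%classic (measurable_itv _).
by congr (measurable (_ `&` _)); apply/seteqP; split => r /=; rewrite in_itv/=.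
Qed.

Lemma cell_preimage (F : W -> 'M[R]_(m, n)) k c :
  (@dyadic_cell R m n k \o F) @^-1` [set c] =
  [set w | forall i j, floor_preimage k (c (i, j)) (F w i j)].
Proof.
rewrite eqEsubset; split => w /=.
  by move=> <- i j; rewrite /floor_preimage /= ffunE.
by move=> h; apply/ffunP => -[i j]; rewrite ffunE /= h.
Qed.

Lemma measurable_box (F : W -> 'M[R]_(m, n)) (A : 'I_m -> 'I_n -> set R) :
  (forall i j, measurable_fun setT (fun w => F w i j)) ->
  (forall i j, measurable (A i j)) ->
  measurable [set w | forall i j, A i j (F w i j)].
Proof.
move=> mF mA.
have -> : [set w | forall i j, A i j (F w i j)] =
    \big[setI/setT]_(ij : 'I_m * 'I_n) ((fun w => F w ij.1 ij.2) @^-1` A ij.1 ij.2).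
  rewrite -bigcap_seq eqEsubset; split => w /= h.
    by move=> ij _; exact: h.
  by move=> i j; apply: (h (i, j)); rewrite /= mem_index_enum.
apply: bigsetI_measurable => ij _; rewrite -[X in measurable X]setTI.
exact: mF.
Qed.

(** At each dyadic level the set is replaced by a countable disjoint union of
    boxes; continuity from above gives the limit. *)
Lemma closed_law_eq (C : set 'M[R]_(m, n)) : closed C ->
  [/\ measurable (Phi @^-1` C), measurable (Psi @^-1` C) &
      P (Phi @^-1` C) = P (Psi @^-1` C)].
Proof.
move=> cC; pose J k := @dyadic_cell R m n k @` C.
have level k : [/\ measurable (Phi @^-1` (dyadic_cell k @^-1` J k)),
    measurable (Psi @^-1` (dyadic_cell k @^-1` J k)) &
    P (Phi @^-1` (dyadic_cell k @^-1` J k)) = P (Psi @^-1` (dyadic_cell k @^-1` J k))].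
  apply: (@countable_law_eq _ _ _ P _ (dyadic_cell k \o Phi) (dyadic_cell k \o Psi)).
  - move=> c; rewrite cell_preimage.
    exact: (measurable_box mPhi (fun i j => measurable_floor_preimage k (c (i, j)))).
  - move=> c; rewrite cell_preimage.
    exact: (measurable_box mPsi (fun i j => measurable_floor_preimage k (c (i, j)))).
  - move=> c; rewrite !cell_preimage.
    exact: (box_eq (fun i j => measurable_floor_preimage k (c (i, j)))).
have cvgP (F : W -> 'M[R]_(m, n)) :
    (forall k, measurable (F @^-1` (dyadic_cell k @^-1` J k))) ->
    measurable (F @^-1` C) /\
    P (F @^-1` (dyadic_cell k @^-1` J k)) @[k --> \oo] --> P (F @^-1` C).
  move=> mF; have -> : F @^-1` C = \bigcap_k (F @^-1` (dyadic_cell k @^-1` J k)).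
    by rewrite {1}(closed_dyadic_cells cC) preimage_bigcap.
  have mI : measurable (\bigcap_k (F @^-1` (dyadic_cell k @^-1` J k))).
    exact: bigcapT_measurable.
  split => //; apply: nonincreasing_cvg_mu => //.
    by rewrite -ge0_fin_numE ?measure_ge0// fin_num_measure.
  apply/nonincreasing_seqP => k; apply/subsetPset => w /= [p Cp pw].
  by exists p => //; exact: dyadic_cellS.
have mJ1 k : measurable (Phi @^-1` (dyadic_cell k @^-1` J k)) by have [] := level k.
have mJ2 k : measurable (Psi @^-1` (dyadic_cell k @^-1` J k)) by have [] := level k.
have [m1 c1] := cvgP Phi mJ1; have [m2 c2] := cvgP Psi mJ2.
split => //; move: c1.
have -> : (fun k => P (Phi @^-1` (dyadic_cell k @^-1` J k))) =
    (fun k => P (Psi @^-1` (dyadic_cell k @^-1` J k))).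
  by apply/funext => k; have [] := level k.
move=> /(cvg_lim (@ereal_hausdorff R)) <-.
by rewrite (cvg_lim (@ereal_hausdorff R) c2).
Qed.

(** Finite unions of closed sets are closed, so continuity from below applies to
    the partial unions. *)
Lemma bigcup_closed_law_eq (I : countType) (C : I -> set 'M[R]_(m, n)) :
  (forall i, closed (C i)) ->
  [/\ measurable (Phi @^-1` (\bigcup_i C i)), measurable (Psi @^-1` (\bigcup_i C i)) &
      P (Phi @^-1` (\bigcup_i C i)) = P (Psi @^-1` (\bigcup_i C i))].
Proof.
move=> cC; pose D k := if choice.unpickle k is Some i then C i else set0.
pose U k := \big[setU/set0]_(j < k) D j.
have cU k : closed (U k).
  apply: closed_bigsetU => j _; rewrite /D.
  by case: (choice.unpickle j) => [i|]; [exact: cC|exact: closed0].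
have UE : \bigcup_i C i = \bigcup_k U k.
  rewrite eqEsubset; split => p.
    move=> [i _ Cip]; exists (choice.pickle i).+1 => //.
    rewrite /U -bigcup_mkord; exists (choice.pickle i) => //=.
    by rewrite /D choice.pickleK.
  move=> [k _]; rewrite /U -bigcup_mkord => -[j _]; rewrite /D.
  by case: (choice.unpickle j) => [i|//] Cip; exists i.
have cvgP (F : W -> 'M[R]_(m, n)) : (forall k, measurable (F @^-1` U k)) ->
    measurable (F @^-1` (\bigcup_k U k)) /\
    P (F @^-1` U k) @[k --> \oo] --> P (F @^-1` (\bigcup_k U k)).
  move=> mF; rewrite preimage_bigcup.
  have mI : measurable (\bigcup_k (F @^-1` U k)) by exact: bigcupT_measurable.
  split => //; apply: nondecreasing_cvg_mu => //.
  apply/nondecreasing_seqP => k; apply/subsetPset => w /=.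
  by rewrite /U big_ord_recr/=; left.
have mJ1 k : measurable (Phi @^-1` U k) by have [] := closed_law_eq (cU k).
have mJ2 k : measurable (Psi @^-1` U k) by have [] := closed_law_eq (cU k).
rewrite UE; have [m1 c1] := cvgP Phi mJ1; have [m2 c2] := cvgP Psi mJ2.
split => //; move: c1.
have -> : (fun k => P (Phi @^-1` U k)) = (fun k => P (Psi @^-1` U k)).
  by apply/funext => k; have [] := closed_law_eq (cU k).
move=> /(cvg_lim (@ereal_hausdorff R)) <-.
by rewrite (cvg_lim (@ereal_hausdorff R) c2).
Qed.

End closed_law.

(** * Independence, atoms and coin tossing *)

Section probability_facts.
Context (d : measure_display) (W : measurableType d) (R : realType).
Context (P : probability W R).

(** By independence the joint law is the product of the laws, and the sections of
    the diagonal are singletons, which are null for the law of [g]. *)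
Lemma independent_neq (f g : W -> R) :
  measurable_fun setT f -> measurable_fun setT g -> independent P f g ->
  (forall c, P [set w | g w = c] = 0%E) -> P [set w | f w = g w] = 0%E.
Proof.
move=> mf mg fg g0.
pose F : {mfun W >-> R} := HB.pack f (isMeasurableFun.Build _ _ _ _ f mf).
pose G : {mfun W >-> R} := HB.pack g (isMeasurableFun.Build _ _ _ _ g mg).
pose h w := (f w, g w).
have mh : measurable_fun setT h by exact: measurable_fun_pair.
pose H : {mfun W >-> (R * R)%type} := HB.pack h (isMeasurableFun.Build _ _ _ _ h mh).
pose diag : set (R * R) := [set p | p.1 = p.2].
have mdiag : measurable diag.
  rewrite (_ : diag = (fun p => p.1 == p.2) @^-1` [set true]).
    rewrite -[X in measurable X]setTI.
    exact: measurable_fun_eqr.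
  by apply/seteqP; split => p /= /eqP.
rewrite -[LHS]/(distribution P H diag).
rewrite -(product_measure_unique (m1 := distribution P F)
  (m2 := distribution P G) (m' := distribution P H) fg mdiag).
apply: integral0_eq => r _ /=; rewrite -[RHS](g0 r); congr (P _).
apply/seteqP; split => w; rewrite /xsection /diag /=; rewrite inE/=.
  by move=> ->.
by move=> ->.
Qed.

(** Almost every section of the set where the two copies differ is null; any
    point with a null section provides the constant. *)
Lemma copies_equal_constant (f : W -> R) : measurable_fun setT f ->
  (P \x P)%E [set w | f w.1 <> f w.2] = 0%E ->
  exists c, P [set w | f w = c] = 1%E.
Proof.
move=> mf; set N := [set w | _] => N0.
have mN : measurable N.
  rewrite (_ : N = (fun w => f w.1 == f w.2) @^-1` [set false]).
    rewrite -[X in measurable X]setTI; apply: measurable_fun_eqr => //.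
      by apply: measurableT_comp => //; exact: measurable_fst.
    by apply: measurableT_comp => //; exact: measurable_snd.
  by apply/seteqP; split => w; rewrite /N/=; [move/eqP/negbTE|move/negbT/eqP].
have /ae_eq_integral_abs : (\int[P]_w `|(P \o xsection N) w| = 0)%E.
  by rewrite -[RHS]N0; apply: eq_integral => w _; rewrite gee0_abs.
move=> /(_ measurableT (measurable_fun_xsection _ mN)) ae0.
have [w Pw] : exists w, P (xsection N w) = 0%E.
  apply: contrapT => /forallNP h.
  have [A [mA A0 sA]] := ae0.
  have AT : A = setT.
    by apply/seteqP; split => // w _; apply: sA => /= /(_ I); exact: h.
  have P0 : P setT = 0%E by rewrite -AT; exact: A0.
  by move: P0; rewrite probability_setT => /eqP; rewrite onee_eq0.
exists (f w).
have mE : measurable [set w' | f w' = f w].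
  rewrite -[X in measurable X]setTI; exact: (mf measurableT [set f w]).
have -> : [set w' | f w' = f w] = ~` xsection N w.
  by apply/seteqP; split => w'; rewrite /xsection /N /= inE /=;
    [move=> -> | move=> /contrapT ->].
rewrite probability_setC ?Pw ?sube0//; exact: measurable_xsection.
Qed.

End probability_facts.

Section coin_tossing_facts.
Context (R : realType) (mu : probability (borel cantor_space) R).

Lemma measurable_closed_borel (T : ptopologicalType) (A : set T) :
  closed A -> measurable (A : set (borel T)).
Proof.
move=> cA; rewrite -[A]setCK; apply: measurableC.
by apply: sub_sigma_algebra; exact: closed_openC.
Qed.

Lemma cantor_set1_measurable (v : cantor_space) :
  measurable ([set v] : set (borel cantor_space)).
Proof.
apply: measurable_closed_borel; apply: accessible_closed_set1.
exact: hausdorff_accessible cantor_space_hausdorff.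
Qed.

(** A point lies in the cylinder fixed by its first k coordinates, of measure
    2 ^- k. *)
Lemma fair_coin_atomless : fair_coin_measure mu -> forall v, mu [set v] = 0%E.
Proof.
move=> fair v.
have mu_le k : (mu [set v] <= (2^-1 ^+ k)%:E)%E.
  pose J := seq_fset tt (iota 0 k).
  have <- : mu [set u : cantor_space | forall i, i \in J -> [set v i] (u i)] =
      (2^-1 ^+ k)%:E.
    rewrite (fair J (fun i => [set v i])).
    rewrite (eq_bigr (fun=> (2^-1 : R)%:E)); last first.
      move=> i _; rewrite !diracE; case: (v i).
        by rewrite memNset// mem_set//= add0e mule1.
      by rewrite (@mem_set _ [set false] false)// memNset//= adde0 mule1.
    rewrite prodEFin big_const_seq count_predT iter_mulr_1 size_seq_fset undup_id ?size_iota//.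
    exact: iota_uniq.
  apply: le_measure; rewrite ?inE.
  - exact: cantor_set1_measurable.
  - apply: measurable_closed_borel.
    rewrite (_ : mkset _ = \bigcap_(i in [set` J])
        ((fun u : cantor_space => u i) @^-1` [set v i])).
      apply: closed_bigI => i _; apply: preimage_closed.
        by move=> u _; exact: (@proj_continuous _ (fun _ : nat => bool) i).
      exact: (accessible_closed_set1 (hausdorff_accessible discrete_hausdorff)).
    by apply/seteqP; split => u /= h i; exact: h.
  - by move=> u ->.
apply/eqP; rewrite eq_le measure_ge0 andbT; apply/lee_addgt0Pr => e e0.
rewrite add0e.
have [k ke] : exists k, 2^-1 ^+ k <= e :> R.
  have [k _ /(_ k (leqnn k))] := near_infty_natSinv_lt (PosNum e0).
  move=> /= ke; exists k; apply: le_trans (ltW ke).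
  rewrite exprVn lef_pV2 ?posrE ?exprn_gt0//.
  by rewrite -natrX ler_nat; exact: ltn_expl.
by apply: (le_trans (mu_le k)); rewrite lee_fin.
Qed.

End coin_tossing_facts.

(** * Evaluation of paths at random times *)

(** Measurability tested on continuous functions only. Random states are used
    through such functions, for which limits in the path are limits of real
    numbers. *)
Definition observable (d : measure_display) (W : measurableType d) (R : realType)
    (V : W -> state R) : Prop :=
  forall g : state R -> R, continuous g -> measurable_fun setT (g \o V).

Section measurable_paths.
Context (d : measure_display) (W : measurableType d) (R : realType).

Lemma measurable_gtP (f : W -> R) :
  (forall a, measurable [set w | a < f w]) -> measurable_fun setT f.
Proof.
move=> mf; apply: (measurability _ (RGenOInfty.measurableE R)) => _ [_ [a ->] <-].
rewrite setTI; have -> : f @^-1` `]a, +oo[%classic = [set w | a < f w].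
  by apply/seteqP; split => w /=; rewrite in_itv/= andbT.
exact: mf.
Qed.

Lemma measurable_eq_fun (f g : W -> R) : measurable_fun setT f -> measurable_fun setT g ->
  measurable [set w | f w = g w].
Proof.
move=> mf mg; rewrite (_ : mkset _ = (fun w => f w == g w) @^-1` [set true]).
  by rewrite -[X in measurable X]setTI; exact: measurable_fun_eqr.
by apply/seteqP; split => w /= /eqP.
Qed.

Lemma measurable_le_fun (f g : W -> R) : measurable_fun setT f -> measurable_fun setT g ->
  measurable [set w | f w <= g w].
Proof.
move=> mf mg; rewrite (_ : mkset _ = (fun w => f w <= g w) @^-1` [set true]).
  by rewrite -[X in measurable X]setTI; exact: measurable_fun_ler.
by apply/seteqP; split => w /=.
Qed.

Lemma measurable_nat_case (N : W -> nat) (G : nat -> W -> R) :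
  (forall j, measurable (N @^-1` [set j])) ->
  (forall j, measurable_fun setT (G j)) -> measurable_fun setT (fun w => G (N w) w).
Proof.
move=> mN mG _ B mB; rewrite setTI.
have -> : (fun w => G (N w) w) @^-1` B = \bigcup_j (N @^-1` [set j] `&` G j @^-1` B).
  by apply/seteqP; split => [w BG|w [j _ [<-]]//]; exists (N w).
apply: bigcupT_measurable => j; apply: measurableI; first exact: mN.
by rewrite -[X in measurable X]setTI; exact: mG.
Qed.

(** The representative is not continuous on the circle, but for 0 <= a < 1 the set
    where it exceeds [a] is the one where the continuous [phase_test a] is
    positive. *)
Lemma observable_circle_repr (V : W -> state R) : observable V ->
  measurable_fun setT (fun w => circle_repr (V w).2).
Proof.
move=> mV; apply: measurable_gtP => a.
have [a0|a0] := ltP a 0.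
  rewrite (_ : mkset _ = setT)//; apply/seteqP; split => w //= _.
  by have /andP[z0 _] := circle_repr_itv (V w).2; exact: lt_le_trans z0.
have [a1|a1] := ltP a 1; last first.
  rewrite (_ : mkset _ = set0)//; apply/seteqP; split => w //= aw.
  by have /andP[_ z1] := circle_repr_itv (V w).2; lra.
have gc : continuous (fun s : state R => phase_test a s.2).
  move=> s; apply: (@continuous_comp _ _ _ snd (phase_test a)).
    exact: cvg_snd.
  exact: phase_test_continuous.
rewrite (_ : mkset _ = ((fun s : state R => phase_test a s.2) \o V) @^-1` `]0, +oo[%classic).
  rewrite -[X in measurable X]setTI; apply: (mV _ gc) => //.
by apply/seteqP; split => w /=; rewrite in_itv/= andbT phase_test_gt0// a0.
Qed.

End measurable_paths.

Lemma observable_eval (R : realType) (t : R) : 0 <= t ->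
  observable (fun f : path_space R => (f : cadlag_path R) t).
Proof.
move=> t0 g gc; apply: measurable_gtP => a.
apply: sub_sigma_algebra; exists t, (g @^-1` [set r | a < r]); split => //.
apply: sub_sigma_algebra; move/continuousP : gc; apply; exact: open_gt.
Qed.

(** The least multiple of 1 / (k + 1) strictly above [t]: a grid point on the
    side from which paths are continuous. *)
Definition grid_time (R : realType) (t : R) (k : nat) : R :=
  (Num.truncn (t * k.+1%:R)).+1%:R / k.+1%:R.

Lemma grid_time_cvg (R : realType) (t : R) : 0 <= t ->
  (forall k, t < grid_time t k) /\ grid_time t k @[k --> \oo] --> t.
Proof.
move=> t0; have kp k : 0 < k.+1%:R :> R by [].
have bnd k : t < grid_time t k <= t + k.+1%:R^-1.
  have /truncn_itv/andP[h0 h1] : 0 <= t * k.+1%:R by rewrite mulr_ge0.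
  rewrite /grid_time ltr_pdivlMr// h1/= ler_pdivrMr// mulrDl mulVf//.
  by rewrite -natr1 lerD2r.
split=> [k|]; first by have /andP[] := bnd k.
apply: (@squeeze_cvgr _ _ _ _ (fun=> t) (fun k => t + k.+1%:R^-1)).
- by near=> k; have /andP[/ltW -> ->] := bnd k.
- exact: cvg_cst.
- rewrite -[X in _ --> X]addr0; apply: cvgD; first exact: cvg_cst.
  exact: cvg_harmonic.
Unshelve. all: by end_near. Qed.

Lemma cadlag_grid (R : realType) (f : cadlag_path R) (g : state R -> R) (t : R) :
  0 <= t -> continuous g -> g (f (grid_time t k)) @[k --> \oo] --> g (f t).
Proof.
move=> t0 gc; have [tg tc] := grid_time_cvg t0.
have [rc _] := path_cadlag f.
have : (g \o f) s @[s --> t^'+] --> g (f t).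
  exact: (cvg_comp _ _ (rc t t0) (gc (f t))).
by move=> /cvg_at_rightP; apply; split.
Qed.

(** The random time is approximated from the right by grid times. These take
    countably many values, and right-continuity gives convergence. *)
Lemma observable_random_time (d : measure_display) (W : measurableType d)
    (R : realType) (X : W -> path_space R) (s : W -> R) :
  measurable_fun setT X -> measurable_fun setT s -> (forall w, 0 <= s w) ->
  observable (fun w => (X w : cadlag_path R) (s w)).
Proof.
move=> mX ms s0 g gc.
apply: (@measurable_fun_cvg _ _ _ _
  (fun k w => g ((X w : cadlag_path R) (grid_time (s w) k)))); last first.
  by move=> w _; exact: cadlag_grid.
move=> k.
apply: (@measurable_nat_case _ _ _ (fun w => Num.truncn (s w * k.+1%:R))
  (fun j w => g ((X w : cadlag_path R) (j.+1%:R / k.+1%:R)))) => j.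
  rewrite (_ : _ @^-1` _ = s @^-1` `[j%:R / k.+1%:R, j.+1%:R / k.+1%:R[%classic).
    by rewrite -[X in measurable X]setTI; exact: ms.
  apply/seteqP; split => w /=; rewrite in_itv/= ler_pdivrMr// ltr_pdivlMr//.
    by move=> <-; apply: truncn_itv; rewrite mulr_ge0.
  exact: truncn_def.
have jk0 : 0 <= j.+1%:R / k.+1%:R :> R by rewrite divr_ge0.
exact: (measurableT_comp (observable_eval jk0 gc) mX).
Qed.

(** * Decoding the itinerary from the path *)

Lemma seq_limit_unique (R : realType) (u : nat -> R) (a b : R) :
  u k @[k --> \oo] --> a -> u k @[k --> \oo] --> b -> a = b.
Proof. by move=> /(cvg_lim (@Rhausdorff R)) <- /(cvg_lim (@Rhausdorff R)) <-. Qed.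

Section decoding.
Context (R : realType) (L : set R) (l : cantor_space * cantor_space -> L).
Context (x : state R).
Hypotheses (L_sub : L `<=` @middle_third_cantor R) (l_homeo : homeomorphism l).
Implicit Types (f : R -> state R) (v : nat -> cantor_space).

Definition state_len (s : state R) : R := len l s.1.1 s.1.2.
Definition tail_code (s : state R) : R := code l s.1.1.
Definition head_code (s : state R) : R := code l s.1.2.

(** The departure time along edge [n] as read off the path. The edge entered at a
    jump time is the one the path is on at that time; the initial edge is taken
    from [x] because its departure time may be negative. *)
Fixpoint clock f n : R :=
  if n is m.+1 then clock f m + state_len (if m is 0 then x else f (clock f m))
  else - (circle_repr x.2 * state_len x).

Definition stage f n : state R := if n is 0 then x else f (clock f n).

Lemma clockS f n : clock f n.+1 = clock f n + state_len (stage f n).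
Proof. by case: n. Qed.

Lemma state_len_ge1 s : 1 <= state_len s.
Proof. exact: len_ge1. Qed.

Lemma clock0_le0 f : clock f 0 <= 0.
Proof.
rewrite /= oppr_le0 mulr_ge0//; first by have /andP[] := circle_repr_itv x.2.
exact: le_trans (state_len_ge1 _).
Qed.

Lemma clock_ge0 f n : 0 <= clock f n.+1.
Proof.
elim: n => [|n IH]; rewrite clockS.
  have /andP[z0 /ltW z1] := circle_repr_itv x.2; rewrite /=.
  by rewrite addrC subr_ge0 ler_piMl// (le_trans _ (state_len_ge1 _)).
by rewrite addr_ge0// (le_trans _ (state_len_ge1 _)).
Qed.

Lemma clock_unbounded f (t : R) : 0 <= t ->
  exists n, clock f n <= t < clock f n.+1.
Proof.
move=> t0.
have ge n : n%:R <= clock f n.+1.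
  elim: n => [|n IH]; first exact: clock_ge0.
  by rewrite clockS -natr1 lerD// state_len_ge1.
have ex : exists n, t < clock f n.
  exists (Num.truncn t).+2; apply: lt_le_trans (ge _).
  by have /andP[] := truncn_itv t0.
case: (ex_minnP ex) => -[|n] tn nmin.
  by have := le_trans (clock0_le0 f) t0; rewrite leNgt tn.
exists n; rewrite tn andbT leNgt; by apply/negP => /nmin; rewrite ltnn.
Qed.

Lemma state_len_continuous : continuous state_len.
Proof.
apply: (len_continuous l_homeo) => s.
  by apply: (@continuous_comp _ _ _ fst fst); exact: cvg_fst.
by apply: (@continuous_comp _ _ _ fst snd); [exact: cvg_fst|exact: cvg_snd].
Qed.

Lemma tail_code_continuous : continuous tail_code.
Proof.
apply: (len_continuous l_homeo) => s; last exact: cvg_cst.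
by apply: (@continuous_comp _ _ _ fst fst); exact: cvg_fst.
Qed.

Lemma head_code_continuous : continuous head_code.
Proof.
apply: (len_continuous l_homeo) => s; last exact: cvg_cst.
by apply: (@continuous_comp _ _ _ fst snd); [exact: cvg_fst|exact: cvg_snd].
Qed.

(** The position at time [t] is the one predicted by the decoded itinerary. *)
Definition traverses f (t : R) : Prop := forall n, clock f n <= t < clock f n.+1 ->
  state_len (f t) = state_len (stage f n) /\
  circle_repr (f t).2 * state_len (stage f n) = t - clock f n.

(** Only countably many times are tested, to keep the set of regular paths
    measurable; they include all grid times. *)
Definition regular f : Prop :=
  [/\ forall n, tail_code (stage f n.+1) = head_code (stage f n),
      forall j k, traverses f (j.+1%:R / k.+1%:R) &
      forall i j, head_code (stage f i) = head_code (stage f (i + j.+1)%N) -> False].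

(** The next jump time is a function of the path up to the present one, and the
    next edge is the path evaluated at that time, so both are measurable by
    simultaneous induction. *)
Lemma measurable_clock_stage n :
  measurable_fun setT (fun f : path_space R => clock (f : cadlag_path R) n) /\
  observable (fun f : path_space R => stage (f : cadlag_path R) n).
Proof.
elim: n => [|n [IHc IHs]]; first by split => [|g gc];
  [|rewrite /comp/=]; exact: measurable_cst.
have mc : measurable_fun setT (fun f : path_space R => clock (f : cadlag_path R) n.+1).
  under eq_fun do rewrite clockS.
  by apply: measurable_funD => //; exact: (IHs _ state_len_continuous).
split => //; apply: (@observable_random_time _ (path_space R) R id
   (fun f : path_space R => clock (f : cadlag_path R) n.+1)) => //.
by move=> f; exact: clock_ge0.
Qed.

Lemma measurable_clock n :
  measurable_fun setT (fun f : path_space R => clock (f : cadlag_path R) n).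
Proof. by have [] := measurable_clock_stage n. Qed.

Lemma observable_stage n :
  observable (fun f : path_space R => stage (f : cadlag_path R) n).
Proof. by have [] := measurable_clock_stage n. Qed.

Lemma measurable_traverses (t : R) : 0 <= t ->
  measurable [set f : path_space R | traverses (f : cadlag_path R) t].
Proof.
move=> t0.
have ms n := observable_stage n state_len_continuous.
have mt := observable_eval t0 state_len_continuous.
have mz := observable_circle_repr (observable_eval t0).
have -> : [set f : path_space R | traverses (f : cadlag_path R) t] = \bigcap_n
    (~` ([set f : path_space R | clock (f : cadlag_path R) n <= t] `&`
         ~` [set f : path_space R | clock (f : cadlag_path R) n.+1 <= t]) `|`
     ([set f : path_space R | state_len ((f : cadlag_path R) t) =
         state_len (stage (f : cadlag_path R) n)] `&`
      [set f : path_space R | circle_repr ((f : cadlag_path R) t).2 *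
         state_len (stage (f : cadlag_path R) n) = t - clock (f : cadlag_path R) n])).
  rewrite eqEsubset; split => f /=.
    move=> h n _; have [[c1 /negP c2]|] :=
      pselect (clock f n <= t /\ ~ clock f n.+1 <= t); last by left.
    by right; apply: h; rewrite c1 ltNge.
  move=> h n /andP[c1 c2]; have [|//] := h n I.
  by case; split => //; apply/negP; rewrite -ltNge.
apply: bigcapT_measurable => n; apply: measurableU.
  apply: measurableC; apply: measurableI; last apply: measurableC;
    by apply: measurable_le_fun => //; exact: measurable_clock.
apply: measurableI; first exact: (measurable_eq_fun mt (ms n)).
apply: (measurable_eq_fun (measurable_funM mz (ms n))).
by apply: measurable_funB => //; exact: measurable_clock.
Qed.

Lemma measurable_regular :
  measurable [set f : path_space R | regular (f : cadlag_path R)].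
Proof.
have mt n := observable_stage n tail_code_continuous.
have mh n := observable_stage n head_code_continuous.
have -> : [set f : path_space R | regular (f : cadlag_path R)] =
  (\bigcap_n [set f : path_space R | tail_code (stage (f : cadlag_path R) n.+1) =
                                     head_code (stage (f : cadlag_path R) n)]) `&`
  (\bigcap_j \bigcap_k
     [set f : path_space R | traverses (f : cadlag_path R) (j.+1%:R / k.+1%:R)]) `&`
  (\bigcap_i \bigcap_j ~` [set f : path_space R | head_code (stage (f : cadlag_path R) i) =
                                     head_code (stage (f : cadlag_path R) (i + j.+1)%N)]).
  rewrite eqEsubset; split => f /=.
    move=> [h1 h2 h3]; split; [split|] => [n _|j _ k _|i _ j _].
    - exact: h1.
    - exact: h2.
    - exact: h3.
  move=> [[h1 h2] h3]; split => [n|j k|i j].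
  - exact: h1.
  - exact: (h2 j I k I).
  - exact: (h3 i I j I).
apply: measurableI; first apply: measurableI.
- by apply: bigcapT_measurable => n; apply: measurable_eq_fun; [exact: mt|exact: mh].
- apply: bigcapT_measurable => j; apply: bigcapT_measurable => k.
  by apply: measurable_traverses; rewrite divr_ge0.
- apply: bigcapT_measurable => i; apply: bigcapT_measurable => j.
  by apply: measurableC; apply: measurable_eq_fun; exact: mh.
Qed.

(** The grid times above [t] eventually precede the next jump. There the edge
    length is constant and the phase affine in time, and both pass to the limit
    by right-continuity; the phase does so through [phase_test]. *)
Lemma regular_traverses (f : cadlag_path R) (t : R) :
  regular f -> 0 <= t -> traverses f t.
Proof.
move=> [_ gr _] t0 n; set c := clock f n; set E := state_len (stage f n) => tn.
have E0 : 0 < E by exact: lt_le_trans (state_len_ge1 _).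
have [tg tc] := grid_time_cvg t0.
have near_n : \forall k \near \oo, state_len (f (grid_time t k)) = E /\
    circle_repr (f (grid_time t k)).2 = (grid_time t k - c) / E.
  have : \forall k \near \oo, grid_time t k < clock f n.+1.
    by apply: (cvgr_lt t tc); have /andP[] := tn.
  apply: filterS => k tk.
  have [|h1 h2] := gr (Num.truncn (t * k.+1%:R)) k n.
    rewrite -/(grid_time t k) tk andbT (le_trans _ (ltW (tg k)))//.
    by have /andP[] := tn.
  by split; [exact: h1|rewrite -[X in X / E]h2 mulfK// gt_eqF].
have fE : state_len (f t) = E.
  apply: (seq_limit_unique (@cadlag_grid _ f _ _ t0 state_len_continuous)).
  by apply: cvg_near_cst; apply: filterS near_n => k [].
split => //.
pose z := (t - c) / E.
have z01 : 0 <= z < 1.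
  have /andP[t1 t2] := tn; rewrite clockS -/c -/E in t2.
  rewrite /z divr_ge0 ?subr_ge0 ?(ltW E0)//= ltr_pdivrMr// mul1r; lra.
suff -> : circle_repr (f t).2 = z by rewrite /z divfK// gt_eqF.
rewrite -(circle_repr_mod1 z01); apply: phase_test_inj => a.
have gc : continuous (fun s : state R => phase_test a s.2).
  move=> s; apply: (@continuous_comp _ _ _ snd (phase_test a)).
    exact: cvg_snd.
  exact: phase_test_continuous.
apply: (seq_limit_unique (@cadlag_grid _ f _ _ t0 gc)).
have mc : {for z, continuous (phase_test a \o @mod1 R)}.
  apply: (@continuous_comp _ _ _ (@mod1 R) (phase_test a)).
    exact: pi_continuous.
  exact: phase_test_continuous.
have zc : (grid_time t k - c) / E @[k --> \oo] --> z.
  by apply: cvgMl; apply: cvgB => //; exact: cvg_cst.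
apply: cvg_trans (cvg_comp _ _ zc mc); apply: near_eq_cvg.
by apply: filterS near_n => k [_ hk] /=; rewrite -hk circle_reprK.
Qed.

Definition itinerary f : nat -> cantor_space := fun n => (stage f n.+1).1.2.

Lemma itinerary_vertex f n : vertex x (itinerary f) n = (stage f n).1.2.
Proof. by case: n. Qed.

Lemma itinerary_simple f : regular f -> forall n, simple x (itinerary f) n.
Proof.
move=> [_ _ inj] n i j _ _; rewrite !itinerary_vertex => hij.
have [ij|ji|//] := ltngtP i j.
  by case: (inj i (j - i.+1)%N); rewrite addnS -addSn subnKC// /head_code hij.
by case: (inj j (i - j.+1)%N); rewrite addnS -addSn subnKC// /head_code hij.
Qed.

Lemma itinerary_edge f n : regular f -> edge l x (itinerary f) n = state_len (stage f n).
Proof.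
move=> [tl _ _]; rewrite /edge /state_len itinerary_vertex.
case: n => [//|n]; rewrite [tail _ _ _]/= itinerary_vertex.
by have /(code_inj l_homeo) -> := tl n.
Qed.

Lemma itinerary_departure f n : regular f -> departure l x (itinerary f) n = clock f n.
Proof.
move=> rf; elim: n => [|n IH]; first by rewrite /departure big_ord0 addr0.
by rewrite clockS -IH /departure big_ord_recr addrA /= itinerary_edge.
Qed.

Lemma regular_fits (f : cadlag_path R) (t : R) : regular f -> 0 <= t ->
  exists n, fits l x (itinerary f) n t (state_len (f t)) (circle_repr (f t).2).
Proof.
move=> rf t0; have [n tn] := clock_unbounded f t0; exists n.
have [h1 h2] := regular_traverses rf t0 tn.
by split; rewrite ?itinerary_edge// itinerary_departure// h1 h2 addrC subrK.
Qed.

End decoding.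

(** * The law of the process *)

Section walks_are_regular.
Context (R : realType) (L : set R) (l : cantor_space * cantor_space -> L).
Context (x : state R).
Hypotheses (L_sub : L `<=` @middle_third_cantor R) (l_homeo : homeomorphism l).
Context (v : nat -> cantor_space) (f : R -> state R).
Hypothesis walk : walks l x v f.

Lemma residualE : residual l x = (1 - circle_repr x.2) * state_len l x.
Proof. by case: x => [[a b] z]. Qed.

(** Decoding a walk recovers the jump times and the edges of the itinerary that
    drives it. *)
Lemma clock_jump n : clock l x f n.+1 = jump l x v n /\
  stage l x f n.+1 = (vertex x v n, vertex x v n.+1, mod1 0).
Proof.
have st n' : clock l x f n'.+1 = jump l x v n' ->
    stage l x f n'.+1 = (vertex x v n', vertex x v n'.+1, mod1 0).
  move=> cE; have [_ /(_ n' (jump l x v n'))] := walk.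
  rewrite lexx /= ltrDl len_gt0// => /(_ isT).
  by rewrite subrr mul0r -cE.
elim: n => [|n [IHc IHs]].
  have cE : clock l x f 1 = jump l x v 0.
    by rewrite clockS /= residualE; ring.
  by split => //; exact: st.
have cE : clock l x f n.+2 = jump l x v n.+1.
  by rewrite clockS IHc IHs.
by split => //; exact: st.
Qed.

Lemma walks_head n : head_code l (stage l x f n) = code l (vertex x v n).
Proof. by case: n => [//|n]; have [_ ->] := clock_jump n. Qed.

Lemma walks_traverses (t : R) : 0 <= t -> traverses l x f t.
Proof.
move=> t0 [|n].
  rewrite (clock_jump 0).1 => /andP[_ t1]; have [/(_ t) + _] := walk.
  rewrite t0 t1 => /(_ isT); case xE : x => [[a b] z] -> /=.
  rewrite /state_len /=.
  have l0 : 0 < len l a b by exact: len_gt0.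
  have /andP[z0 z1] := circle_repr_itv z.
  split => //; rewrite circle_repr_mod1.
    by rewrite opprK mulrDl divfK ?gt_eqF// addrC.
  rewrite addr_ge0 ?divr_ge0// ?(ltW l0)//=.
  move: t1; rewrite /= xE /= => t1.
  by rewrite -ltrBrDl ltr_pdivrMr.
have [cE ->] := clock_jump n; have [cE' _] := clock_jump n.+1.
rewrite cE cE' => tn; have [_ /(_ n t tn) /= ->] := walk.
rewrite /state_len /=; set E := len l _ _.
have E0 : 0 < E by exact: len_gt0.
have /andP[t1 t2] := tn; rewrite /= -/E in t2.
split => //; rewrite circle_repr_mod1 ?divfK ?gt_eqF//.
by rewrite divr_ge0 ?subr_ge0 ?(ltW E0)//= ltr_pdivrMr// mul1r ltrBlDl.
Qed.

Lemma walks_regular :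
  (forall i j, code l (vertex x v i) <> code l (vertex x v (i + j.+1)%N)) ->
  regular l x f.
Proof.
move=> inj; split => [n|j k|i j].
- by rewrite walks_head /tail_code; have [_ ->] := clock_jump n.
- by apply: walks_traverses; rewrite divr_ge0.
- by rewrite !walks_head; exact: inj.
Qed.

End walks_are_regular.

Section law_of_the_walk.
Context (R : realType) (mu : probability (borel cantor_space) R).
Hypothesis mu_fair : fair_coin_measure mu.
Context (L : set R) (l : cantor_space * cantor_space -> L) (x : state R).
Hypothesis l_homeo : homeomorphism l.

Lemma measurable_code : measurable_fun setT (code l : borel cantor_space -> R).
Proof.
apply: measurable_gtP => a; apply: sub_sigma_algebra.
have cc : continuous (code l).
  apply: (@len_continuous _ _ _ l_homeo _ id (fun=> point)) => u;
    [exact: cvg_id|exact: cvg_cst].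
exact: (proj1 (continuousP _) cc [set r | a < r] (@open_gt R a)).
Qed.

Context (d : measure_display) (W : measurableType d) (P : probability W R).
Context (V : {RV P >-> borel cantor_space}^nat).
Hypothesis V_iid : iid mu V.

Lemma code_atomless n c : P [set w | code l (V n w) = c] = 0%E.
Proof.
have [[v vc]|nv] := pselect (exists v, code l v = c).
  rewrite (_ : mkset _ = V n @^-1` [set v]).
    by rewrite V_iid.1 ?fair_coin_atomless//; exact: cantor_set1_measurable.
  apply/seteqP; split => w /=; last by move=> ->.
  by rewrite -vc => /(code_inj l_homeo).
rewrite (_ : mkset _ = set0) ?measure0//; apply/seteqP; split => // w /= h.
by apply: nv; exists (V n w).
Qed.

Lemma measurable_code_V n : measurable_fun setT (fun w => code l (V n w)).
Proof. by apply: (measurableT_comp measurable_code); exact: measurable_funP. Qed.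

Lemma code_independent i j : i != j ->
  independent P (fun w => code l (V i w)) (fun w => code l (V j w)).
Proof.
move=> ij A B mA mB.
have mc C : measurable C -> measurable ((code l : borel cantor_space -> R) @^-1` C).
  by move=> mC; rewrite -[X in measurable X]setTI; exact: measurable_code.
pose D k : set (borel cantor_space) := if k == i then code l @^-1` A else code l @^-1` B.
have mD k : measurable (D k) by rewrite /D; case: ifP => _; exact: mc.
have := V_iid.2 [fset i; j]%fset D mD.
rewrite big_fsetU1 ?inE//= big_seq_fset1 {2 3}/D eqxx eq_sym (negbTE ij) => <-.
congr (P _); rewrite eqEsubset; split => w /=.
  move=> [wA wB] k /=; rewrite !inE /D => /orP[]/eqP ->.
    by rewrite eqxx.
  by rewrite eq_sym (negbTE ij).
move=> h; split.
  by have := h i; rewrite /= /D !inE eqxx; apply.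
by have := h j; rewrite /= /D !inE eqxx orbT eq_sym (negbTE ij); apply.
Qed.

Lemma code_vertex_neq i j :
  P [set w | code l (vertex x (fun n => V n w) i) =
             code l (vertex x (fun n => V n w) (i + j.+1)%N)] = 0%E.
Proof.
rewrite addnS; case: i => [|i] /=.
  by rewrite -[RHS](code_atomless j (code l x.1.2)); congr (P _);
    apply/seteqP; split => w /= ->.
apply: independent_neq; [exact: measurable_code_V|exact: measurable_code_V| |].
  by apply: code_independent; rewrite neq_ltn ltnS leq_addr.
exact: code_atomless.
Qed.

End law_of_the_walk.

(** Both properties are measurable conditions on the path, so they can be
    checked on the space that carries the driving sequence. There the path is
    regular as soon as the vertices are distinct. *)
Lemma is_law_regular (R : realType) (mu : probability (borel cantor_space) R)
    (L : set R) (l : cantor_space * cantor_space -> L) (x : state R)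
    (Q : probability (path_space R) R) :
  fair_coin_measure mu -> L `<=` @middle_third_cantor R -> homeomorphism l ->
  is_law l mu x Q ->
  Q [set f : path_space R | ~ regular l x (f : cadlag_path R)] = 0%E /\
  forall n c, Q [set f : path_space R |
    head_code l (stage l x (f : cadlag_path R) n.+1) = c] = 0%E.
Proof.
move=> mu_fair L_sub l_homeo [d [W [P [V [X [V_iid X_walks Q_eq]]]]]].
split.
  have mR := measurable_regular x L_sub l_homeo.
  rewrite Q_eq; last by apply: measurableC.
  pose N := \bigcup_i \bigcup_j [set w | code l (vertex x (fun n => V n w) i) =
             code l (vertex x (fun n => V n w) (i + j.+1)%N)].
  have N0 : P.-negligible N.
    apply: negligible_bigcup => i; apply: negligible_bigcup => j.
    apply/negligibleP; last exact: (code_vertex_neq mu_fair).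
    apply: measurable_eq_fun.
      by case: i => [|i]; rewrite /=; [exact: measurable_cst|exact: measurable_code_V].
    by rewrite addnS; exact: measurable_code_V.
  rewrite -[LHS]/(P (X @^-1` [set f : path_space R | ~ regular l x (f : cadlag_path R)])).
  apply: measure_negligible.
    rewrite -[Y in measurable Y]setTI.
    exact: (measurable_funP X measurableT _ (measurableC mR)).
  apply: negligibleS N0 => w /= nreg; apply: contrapT => nN; apply: nreg.
  apply: (walks_regular L_sub (X_walks w)) => i j h; apply: nN.
  by exists i => //; exists j.
move=> n c; rewrite Q_eq; last first.
  apply: measurable_eq_fun; last exact: measurable_cst.
  exact: (observable_stage x L_sub l_homeo n.+1 (head_code_continuous l_homeo)).
rewrite -[RHS](code_atomless mu_fair l_homeo V_iid n c); congr (P _).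
have hE w : head_code l (stage l x (X w : cadlag_path R) n.+1) = code l (V n w).
  exact: (walks_head L_sub (X_walks w) n.+1).
apply/seteqP; split => w h; first exact: etrans (esym (hE w)) h.
exact: etrans (hE w) h.
Qed.

(** * Two independent copies *)

Lemma inv_nat_lower_bound (R : realType) (s : seq R) :
  exists k : nat, forall r, r \in s -> 0 < r -> k.+1%:R^-1 <= r.
Proof.
elim: s => [|a s [k hk]]; first by exists 0%N.
have [a0|a0] := ltP 0 a; last first.
  exists k => r; rewrite inE => /orP[/eqP ->|]; last exact: hk.
  by rewrite ltNge a0.
have [j _ /(_ j (leqnn j)) /= ja] := near_infty_natSinv_lt (PosNum a0).
exists (maxn j k) => r; rewrite inE => /orP[/eqP -> _|rs r0].
  by apply: le_trans (ltW ja); rewrite lef_pV2 ?posrE// ler_nat ltnS leq_maxl.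
by apply: le_trans (hk r rs r0); rewrite lef_pV2 ?posrE// ler_nat ltnS leq_maxr.
Qed.

Lemma observable_borel (R : realType) :
  observable (fun s : borel (state R) => s : state R).
Proof.
move=> g gc; apply: measurable_gtP => a; apply: sub_sigma_algebra.
exact: (proj1 (continuousP _) gc [set r | a < r] (@open_gt R a)).
Qed.

Lemma measure_setC_eq (d : measure_display) (W : measurableType d) (R : realType)
    (P : {finite_measure set W -> \bar R}) (A B : set W) :
  measurable A -> measurable B -> P A = P B -> P (~` A) = P (~` B).
Proof.
move=> mA mB AB; have Pfin : (P setT < +oo)%E.
  by rewrite -ge0_fin_numE ?measure_ge0// fin_num_measure.
rewrite -!setTD measureD// [RHS]measureD// !setTI; congr (_ - _)%E.
exact: AB.
Qed.

Section two_copies.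
Context (R : realType) (L : set R) (l : cantor_space * cantor_space -> L).
Context (x : state R).
Hypotheses (L_sub : L `<=` @middle_third_cantor R) (l_homeo : homeomorphism l).
Hypothesis L_indep : rat_independent L.
Context (d : measure_display) (W : measurableType d) (P : probability W R).
Context (X : {RV P >-> path_space R}) (tau : W -> R).
Hypotheses (mtau : measurable_fun setT tau) (tau_ge0 : forall w, 0 <= tau w).

Let Y (w : W) : borel (state R) := (X w : cadlag_path R) (tau w).

Hypothesis tauY : independent P tau Y.
Hypothesis X_regular :
  P [set w | ~ regular l x (X w : cadlag_path R)] = 0%E.
Hypothesis head_atomless : forall n c,
  P [set w | head_code l (stage l x (X w : cadlag_path R) n.+1) = c] = 0%E.

Let rho w := state_len l (Y w).
Let zeta w := circle_repr (Y w).2.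

Definition reading (t y : W) (j : 'I_3) : R := [:: tau t; rho y; zeta y]`_j.

Definition pick_copy (i : 'I_2) (w : W * W) : W := if i == 0 then w.1 else w.2.

(** The observations (t, y), (t', y') of two independent runs, and below the
    same with the states exchanged. *)
Definition straight (w : W * W) : 'M[R]_(2, 3) :=
  \matrix_(i, j) reading (pick_copy i w) (pick_copy i w) j.

Definition crossed (w : W * W) : 'M[R]_(2, 3) :=
  \matrix_(i, j) reading (pick_copy i w) (pick_copy i (w.2, w.1)) j.

Lemma observable_Y : observable (Y : W -> state R).
Proof. by apply: observable_random_time => //; exact: measurable_funP. Qed.

Lemma measurable_rho : measurable_fun setT rho.
Proof. exact: (observable_Y (state_len_continuous l_homeo)). Qed.

Lemma measurable_zeta : measurable_fun setT zeta.
Proof. exact: (observable_circle_repr observable_Y). Qed.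

Lemma ord3_cases (A : 'I_3 -> Prop) : A 0 -> A 1 -> A 2 -> forall j, A j.
Proof.
move=> A0 A1 A2 [[|[|[|//]]] lt3].
- by rewrite (_ : Ordinal lt3 = 0)//; exact: val_inj.
- by rewrite (_ : Ordinal lt3 = 1)//; exact: val_inj.
- by rewrite (_ : Ordinal lt3 = 2)//; exact: val_inj.
Qed.

Lemma ord2_cases (A : 'I_2 -> Prop) : A 0 -> A 1 -> forall i, A i.
Proof.
move=> A0 A1 [[|[|//]] lt2].
- by rewrite (_ : Ordinal lt2 = 0)//; exact: val_inj.
- by rewrite (_ : Ordinal lt2 = 1)//; exact: val_inj.
Qed.

Lemma measurable_reading (f g : W * W -> W) j :
  measurable_fun setT f -> measurable_fun setT g ->
  measurable_fun setT (fun w => reading (f w) (g w) j).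
Proof.
move=> mf mg; move: j; apply: ord3_cases; rewrite /reading /=.
- exact: (measurableT_comp mtau mf).
- exact: (measurableT_comp measurable_rho mg).
- exact: (measurableT_comp measurable_zeta mg).
Qed.

Lemma measurable_pick_copy i : measurable_fun setT (pick_copy i).
Proof.
by rewrite /pick_copy; case: (i == 0); [exact: measurable_fst|exact: measurable_snd].
Qed.

Lemma measurable_straight i j : measurable_fun setT (fun w => straight w i j).
Proof.
under eq_fun do rewrite mxE.
by apply: measurable_reading; exact: measurable_pick_copy.
Qed.

Lemma measurable_crossed i j : measurable_fun setT (fun w => crossed w i j).
Proof.
under eq_fun do rewrite mxE.
apply: measurable_reading; first exact: measurable_pick_copy.
by rewrite /pick_copy; case: (i == 0); [exact: measurable_snd|exact: measurable_fst].
Qed.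

Lemma reading_box (A B C : set R) : measurable A -> measurable B -> measurable C ->
  measurable [set w | A (tau w) /\ B (rho w) /\ C (zeta w)] /\
  P [set w | A (tau w) /\ B (rho w) /\ C (zeta w)] =
  (P [set w | A (tau w)] * P [set w | B (rho w) /\ C (zeta w)])%E.
Proof.
move=> mA mB mC.
pose D : set (borel (state R)) := [set s | B (state_len l s) /\ C (circle_repr s.2)].
have mD : measurable D.
  rewrite (_ : D = (state_len l @^-1` B) `&` ((fun s => circle_repr s.2) @^-1` C))//.
  apply: measurableI; rewrite -[Z in measurable Z]setTI.
    exact: (observable_borel (state_len_continuous l_homeo)).
  exact: (observable_circle_repr (@observable_borel R)).
split; last exact: (tauY mA mD).
rewrite (_ : mkset _ = (tau @^-1` A) `&` ((rho @^-1` B) `&` (zeta @^-1` C)))//.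
apply: measurableI; last apply: measurableI; rewrite -[Z in measurable Z]setTI.
- exact: mtau.
- exact: measurable_rho.
- exact: measurable_zeta.
Qed.

(** By independence of time and state in each run, both probabilities are the
    product of the same four factors. *)
Lemma crossed_box (A : 'I_2 -> 'I_3 -> set R) : (forall i j, measurable (A i j)) ->
  (P \x P)%E [set w | forall i j, A i j (straight w i j)] =
  (P \x P)%E [set w | forall i j, A i j (crossed w i j)].
Proof.
move=> mA.
pose box i k := [set w | A i 0 (tau w) /\ A k 1 (rho w) /\ A k 2 (zeta w)].
have straightE : [set w | forall i j, A i j (straight w i j)] = box 0 0 `*` box 1 1.
  rewrite eqEsubset; split => w /=.
    move=> h; split; split; [|split| |split].
    - by have := h 0 0; rewrite mxE.
    - by have := h 0 1; rewrite mxE.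
    - by have := h 0 2; rewrite mxE.
    - by have := h 1 0; rewrite mxE.
    - by have := h 1 1; rewrite mxE.
    - by have := h 1 2; rewrite mxE.
  move=> [[h1 [h2 h3]] [h4 [h5 h6]]].
  by apply: ord2_cases; apply: ord3_cases; rewrite mxE.
have crossedE : [set w | forall i j, A i j (crossed w i j)] = box 0 1 `*` box 1 0.
  rewrite eqEsubset; split => w /=.
    move=> h; split; split; [|split| |split].
    - by have := h 0 0; rewrite mxE.
    - by have := h 1 1; rewrite mxE.
    - by have := h 1 2; rewrite mxE.
    - by have := h 1 0; rewrite mxE.
    - by have := h 0 1; rewrite mxE.
    - by have := h 0 2; rewrite mxE.
  move=> [[h1 [h2 h3]] [h4 [h5 h6]]].
  by apply: ord2_cases; apply: ord3_cases; rewrite mxE.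
have mbox i k : measurable (box i k) by have [] := reading_box (mA i 0) (mA k 1) (mA k 2).
have Pbox i k : P (box i k) = (P [set w | A i 0%R (tau w)] *
    P [set w | A k 1%R (rho w) /\ A k 2%R (zeta w)])%E.
  by have [] := reading_box (mA i 0) (mA k 1) (mA k 2).
have PPbox i k i' k' :
    (P \x P)%E (box i k `*` box i' k') = (P (box i k) * P (box i' k'))%E.
  exact: product_measure1E.
rewrite straightE crossedE !PPbox !Pbox.
by rewrite muleACA [RHS]muleACA [X in (_ * X)%E]muleC.
Qed.


Let patterns (nmk : nat * nat * nat) : set 'M[R]_(2, 3) :=
  pair_fit l x nmk.1.1 nmk.1.2 nmk.2.+1%:R^-1.

(** Finitely many distances between distinct heads are involved, so they have a
    common positive lower bound of the form 1 / (k + 1). *)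
Lemma straight_fits w : regular l x (X w.1 : cadlag_path R) ->
  regular l x (X w.2 : cadlag_path R) ->
  (forall i j, head_code l (stage l x (X w.1 : cadlag_path R) i.+1) <>
               head_code l (stage l x (X w.2 : cadlag_path R) j.+1)) ->
  (\bigcup_nmk patterns nmk) (straight w).
Proof.
move=> r1 r2 r12.
have [n fn] := regular_fits L_sub l_homeo r1 (tau_ge0 w.1).
have [m fm] := regular_fits L_sub l_homeo r2 (tau_ge0 w.2).
pose v1 := itinerary l x (X w.1 : cadlag_path R).
pose v2 := itinerary l x (X w.2 : cadlag_path R).
pose dist u1 u2 i j := `|code l (vertex x u1 i) - code l (vertex x u2 j)|.
pose I k := iota 0 k.+1.
have [k hk] := inv_nat_lower_bound
  ([seq dist v1 v1 i j | i <- I n, j <- I n] ++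
   [seq dist v2 v2 i j | i <- I m, j <- I m] ++
   [seq dist v1 v2 i j | i <- I n, j <- I m]).
have mem_dist u1 u2 p p' i j : (i <= p)%N -> (j <= p')%N ->
    dist u1 u2 i j \in [seq dist u1 u2 i j | i <- I p, j <- I p'].
  by move=> ip jp; apply: allpairs_f; rewrite mem_iota ltnS.
exists (n, m, k) => //; exists (fun bi => if bi.1 then v2 bi.2 else v1 bi.2).
split => /=.
- move=> i j /andP[ij jn]; apply: hk.
    rewrite mem_cat; apply/orP; left.
    exact: (mem_dist v1 v1 _ _ _ _ (leq_trans (ltnW ij) jn) jn).
  rewrite normr_gt0 subr_eq0; apply/negP => /eqP/(code_inj l_homeo).
  move=> /(itinerary_simple r1 (leq_trans (ltnW ij) jn) jn) ij'.
  by rewrite ij' ltnn in ij.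
- move=> i j /andP[ij jn]; apply: hk.
    rewrite mem_cat; apply/orP; right; rewrite mem_cat; apply/orP; left.
    exact: (mem_dist v2 v2 _ _ _ _ (leq_trans (ltnW ij) jn) jn).
  rewrite normr_gt0 subr_eq0; apply/negP => /eqP/(code_inj l_homeo).
  move=> /(itinerary_simple r2 (leq_trans (ltnW ij) jn) jn) ij'.
  by rewrite ij' ltnn in ij.
- move=> [//|i] [//|j] /andP[_ ni] /andP[_ mj]; apply: hk.
    rewrite mem_cat; apply/orP; right; rewrite mem_cat; apply/orP; right.
    exact: (mem_dist v1 v2 _ _ _ _ ni mj).
  rewrite normr_gt0 subr_eq0; apply/negP => /eqP; exact: r12.
- by rewrite !mxE.
- by rewrite !mxE.
Qed.

Lemma separated_simple v n (e : R) : 0 < e ->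
  (forall i j, (i < j <= n)%N ->
    e <= `|code l (vertex x v i) - code l (vertex x v j)|) -> simple x v n.
Proof.
move=> e0 sep i j ni nj vij; have [ij|ji|//] := ltngtP i j.
  by have := sep i j; rewrite ij nj vij subrr normr0 leNgt e0 => /(_ isT).
by have := sep j i; rewrite ji ni vij subrr normr0 leNgt e0 => /(_ isT).
Qed.

(** The exchanged observations may be explained by itineraries unrelated to the
    two runs; [exchange_itineraries] only needs that they exist. *)
Lemma straight_crossed_eq w : (\bigcup_nmk patterns nmk) (straight w) ->
  (\bigcup_nmk patterns nmk) (crossed w) -> tau w.1 = tau w.2.
Proof.
move=> [[[n m] k] _ [q /= [s1 s2 s12 f1 f2]]].
move=> [[[n' m'] k'] _ [q' /= [_ s2' _ f1' f2']]].
rewrite !mxE /= in f1 f2 f1' f2'.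
have e0 p : 0 < p.+1%:R^-1 :> R by rewrite invr_gt0.
apply: (exchange_itineraries l_homeo L_indep _ _ _ _ f1 f2 f1' f2').
- exact: separated_simple (e0 k) s1.
- exact: separated_simple (e0 k) s2.
- move=> i j hi hj hij; have := s12 i j hi hj.
  by rewrite hij subrr normr0 leNgt e0.
- exact: separated_simple (e0 k') s2'.
Qed.

Let head (n : nat) (w : W) := head_code l (stage l x (X w : cadlag_path R) n.+1).

Let PP : subprobability (W * W)%type R :=
  product_subprobability (P : subprobability W R, P : subprobability W R).

Lemma measurable_head n : measurable_fun setT (head n).
Proof.
have := observable_stage x L_sub l_homeo n.+1 (head_code_continuous l_homeo).
by move=> mh; apply: (measurableT_comp mh); exact: measurable_funP.
Qed.

Lemma irregular_negligible i :
  PP.-negligible [set w | ~ regular l x (X (pick_copy i w) : cadlag_path R)].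
Proof.
pose A := [set w | ~ regular l x (X w : cadlag_path R)].
have mA : measurable A.
  rewrite -[Z in measurable Z]setTI.
  exact: (measurable_funP X measurableT _
    (measurableC (measurable_regular x L_sub l_homeo))).
move: i; apply: ord2_cases.
  exists (A `*` setT); split; first exact: measurableX.
    transitivity (P A * P setT)%E; first exact: product_measure1E.
    by rewrite X_regular mul0e.
  by move=> w h; split.
exists (setT `*` A); split; first exact: measurableX.
  transitivity (P setT * P A)%E; first exact: product_measure1E.
  by rewrite X_regular mule0.
by move=> w h; split.
Qed.

Lemma meeting_negligible i j : PP.-negligible [set w | head i w.1 = head j w.2].
Proof.
have mE : measurable [set w : W * W | head i w.1 = head j w.2].
  apply: measurable_eq_fun.
    exact: (measurableT_comp (measurable_head i) measurable_fst).
  exact: (measurableT_comp (measurable_head j) measurable_snd).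
apply/negligibleP => //; apply: integral0_eq => w _ /=.
rewrite -[RHS](head_atomless j (head i w)); congr (P _).
by apply/seteqP; split => w'; rewrite /xsection /= inE.
Qed.

(** A vertex of the second run is independent of the first run and has no atom,
    so almost surely it avoids each vertex of the first. *)
Lemma straight_fits_ae :
  PP.-negligible (~` (straight @^-1` (\bigcup_nmk patterns nmk))).
Proof.
pose N := \bigcup_i \bigcup_j [set w : W * W | head i w.1 = head j w.2].
have N0 : PP.-negligible N.
  apply: negligible_bigcup => i; apply: negligible_bigcup => j.
  exact: meeting_negligible.
apply: (negligibleS _ (negligibleU (negligibleU (irregular_negligible 0)
  (irregular_negligible 1)) N0)).
move=> w nfit; apply: contrapT => nbad; apply: nfit.
apply: straight_fits.
- by apply: contrapT => h; apply: nbad; left; left.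
- by apply: contrapT => h; apply: nbad; left; right.
- by move=> i j h; apply: nbad; right; exists i => //; exists j.
Qed.

Lemma copies_equal : PP [set w | tau w.1 <> tau w.2] = 0%E.
Proof.
have closed_patterns nmk : closed (patterns nmk) by exact: closed_pair_fit.
have [mS mC SC] := bigcup_closed_law_eq (P := PP)
  measurable_straight measurable_crossed crossed_box closed_patterns.
have S0 := measure_negligible (measurableC mS) straight_fits_ae.
have C0 : PP (~` (crossed @^-1` (\bigcup_nmk patterns nmk))) = 0%E.
  by rewrite -(measure_setC_eq mS mC SC).
have mN : measurable [set w : W * W | tau w.1 <> tau w.2].
  apply: measurableC; apply: measurable_eq_fun.
    exact: (measurableT_comp mtau measurable_fst).
  exact: (measurableT_comp mtau measurable_snd).
apply: (measure_negligible mN).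
apply: (negligibleS _ (negligibleU straight_fits_ae
  (proj2 (negligibleP _ (measurableC mC)) C0))).
move=> w; apply: contra_notP => nbad; apply: straight_crossed_eq.
- by apply: contrapT => h; apply: nbad; left.
- by apply: contrapT => h; apply: nbad; right.
Qed.

Lemma sampling_time_constant : exists c, P [set w | tau w = c] = 1%E.
Proof. exact: (copies_equal_constant mtau copies_equal). Qed.

End two_copies.

Theorem proposition2 (R : realType)
  (mu : probability (borel cantor_space) R) (mu_fair : fair_coin_measure mu)
  (L : set R) (L_sub : L `<=` @middle_third_cantor R)
  (L_cantor : cantor_subset L) (L_indep : rat_independent L)
  (l : cantor_space * cantor_space -> L) (l_homeo : homeomorphism l)
  (x : state R)
  (d : measure_display) (Omega : measurableType d) (P : probability Omega R)
  (X : {RV P >-> path_space R}) (X_law : is_law l mu x (distribution P X))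
  (T : {RV P >-> \bar R}) (T_ge0 : forall w, (0 <= T w)%E)
  (T_fin : P [set w | (T w < +oo)%E] = 1%E) :
  independent P T
    (fun w => (X w : cadlag_path R) (fine (T w)) : borel (state R)) ->
  exists c : \bar R, P [set w | T w = c] = 1%E.
Proof.
move=> TY.
have mT : measurable_fun setT (T : Omega -> \bar R) by exact: measurable_funP.
pose tau w := fine (T w).
have mtau : measurable_fun setT tau by exact: measurableT_comp.
have tau_ge0 w : 0 <= tau w by exact: fine_ge0.
have tauY : independent P tau
    (fun w => (X w : cadlag_path R) (tau w) : borel (state R)).
  move=> A B mA mB; have := TY (fine @^-1` A) B; apply => //.
  rewrite -[Z in measurable Z]setTI.
  exact: (fine_measurable measurableT measurableT mA).
have [X_regular head_atomless] := is_law_regular mu_fair L_sub l_homeo X_law.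
have [c Pc] := sampling_time_constant L_sub l_homeo L_indep mtau tau_ge0 tauY
  X_regular head_atomless.
exists c%:E.
have mc : measurable [set w | tau w = c] by exact: measurable_eq_fun.
have mfin : measurable [set w | (T w < +oo)%E].
  by have := emeasurable_fun_infty_o measurableT mT +oo%E; rewrite setTI.
have mTc : measurable [set w | T w = c%:E].
  rewrite -[Z in measurable Z]setTI.
  exact: (mT measurableT _ (emeasurable_set1 c%:E)).
have null A : measurable A -> P A = 1%E -> P.-negligible (~` A).
  move=> mA PA; apply/negligibleP; first exact: measurableC.
  by have := probability_setC P mA; rewrite PA subee.
have nullTc : P.-negligible (~` [set w | T w = c%:E]).
  apply: (negligibleS _ (negligibleU (null _ mc Pc) (null _ mfin T_fin))).
  move=> w; apply: contra_notP => h.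
  have tc : tau w = c by apply: contrapT => nc; apply: h; left.
  have fin : (T w < +oo)%E by apply: contrapT => ninf; apply: h; right.
  by rewrite -tc /tau fineK// ge0_fin_numE.
have := probability_setC P (measurableC mTc).
by rewrite setCK (measure_negligible (measurableC mTc) nullTc) sube0.
Qed.
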